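(* Let $r$ be even and let $\lambda=(\lambda_1,\ldots,\lambda_r)$ be a strict partition with $\lambda_i\ge 0$. Let $\boldsymbol s=(s_{ij})\in ST^{\mathrm{diag}}(\lambda,\mathbb C)$ be such that the series $\zeta^Q_\lambda(\boldsymbol s)$ and all the series $a_{ij}$ ($1\le i<j\le r$) below converge absolutely. Then \[ \zeta_\lambda^Q(\boldsymbol s)=\mathrm{pf}(M_\lambda), \] where $M_\lambda=(a_{ij})$ is the $r\times r$ strictly upper triangular matrix with \[ a_{ij}=\zeta^Q_{(\lambda_i,\lambda_j)}(\boldsymbol s_{(\lambda_i,\lambda_j)})\qquad(1\le i<j\le r), \] and $\boldsymbol s_{(\lambda_i,\lambda_j)}$ is the shifted tableau of shape $(\lambda_i,\lambda_j)$ whose first row is $(s_{ii},s_{i,i+1},\ldots,s_{i,t_i})$ and whose second row is $(s_{jj},s_{j,j+1},\ldots,s_{j,t_j})$, with $t_i=i+\lambda_i-1$ (the second row being empty if $\lambda_j=0$).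
   Context: A partition $\lambda=(\lambda_1,\ldots,\lambda_r)$ is strict if $\lambda_1>\lambda_2>\cdots>\lambda_r\ge 0$. Its shifted diagram is $SD(\lambda)=\{(i,j)\in\mathbb Z^2 : 1\le i\le r,\ i\le j\le \lambda_i+i-1\}$ (row index $i$ increasing downwards, column index $j$ increasing to the right). $ST(\lambda,X)$ is the set of fillings $(t_{ij})_{(i,j)\in SD(\lambda)}$ with $t_{ij}\in X$, and $ST^{\mathrm{diag}}(\lambda,X)=\{(t_{ij})\in ST(\lambda,X) : t_{ij}=t_{1k}\text{ if } j-i=k-1\}$ (entries constant on diagonals). Let $\mathbb N'=\{1',1,2',2,\ldots\}$ with total order $1'<1<2'<2<\cdots$, and put $|i|=|i'|=i$. $QSST(\lambda)$ is the set of $(m_{ij})\in ST(\lambda,\mathbb N')$ such that the entries are weakly increasing along each row and each column, for each $i=1,2,\ldots$ there is at most one $i'$ in each row, and for each $i$ there is at most one $i$ in each column. The Schur $Q$-multiple zeta function is $\zeta^Q_\lambda(\boldsymbol s)=\sum_{M\in QSST(\lambda)}\prod_{(i,j)\in SD(\lambda)}|m_{ij}|^{-s_{ij}}$ for $\boldsymbol s\in ST(\lambda,\mathbb C)$. For a $2n\times 2n$ upper triangular matrix $A=(a_{ij})$, $\mathrm{pf}(A)=\sum_{\pi\in\mathfrak F_{2n}}\mathrm{sgn}(\pi)\prod_{i=1}^n a_{\pi(2i-1),\pi(2i)}$, where $\mathfrak F_{2n}$ is the set of $\pi\in\mathfrak S_{2n}$ with $\pi(1)<\pi(3)<\cdots<\pi(2n-1)$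 and $\pi(2i-1)<\pi(2i)$ for all $i$. *)

(* Defs.v *)
From HB Require Import structures.
From mathcomp Require Import all_boot all_order all_algebra all_fingroup.
From mathcomp Require Import all_classical all_reals all_analysis.
From mathcomp Require Import complex.

Set Implicit Arguments.
Unset Strict Implicit.
Unset Printing Implicit Defensive.

Import Order.TTheory GRing.Theory Num.Theory.

Local Open Scope classical_set_scope.
Local Open Scope ring_scope.

(* A shape with r rows is given by its row lengths lam : 'I_r -> nat. *)
Definition strict_partition (r : nat) (lam : 'I_r -> nat) : Prop :=
  forall i j : 'I_r, (i < j)%N -> (lam j < lam i)%N.

(* The 0-based pair (i; k) encodes the cell of SD(lam) in row i + 1 and column
   (i + 1) + k; k < lam i is the condition i + 1 <= j <= lam_(i+1) + (i+1) - 1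
   on the column j. *)
Definition cell (r : nat) (lam : 'I_r -> nat) : finType :=
  {i : 'I_r & 'I_(lam i)}.

Definition row_of (r : nat) (lam : 'I_r -> nat) (c : cell lam) : nat := (tag c).+1.

Definition col_of (r : nat) (lam : 'I_r -> nat) (c : cell lam) : nat :=
  ((tag c).+1 + tagged c)%N.

Definition ST (r : nat) (lam : 'I_r -> nat) (X : Type) := {ffun cell lam -> X}.

Definition STdiag (r : nat) (lam : 'I_r -> nat) (X : Type) : set (ST lam X) :=
  [set t | forall c d : cell lam,
     row_of d = 1%N -> (col_of c - row_of c = col_of d - 1)%N -> t c = t d].

(* (i, false) is the primed letter (i + 1)' and (i, true) the unprimed letter
   i + 1; since false < true, the lexicographic order is
   1' < 1 < 2' < 2 < ... *)
Notation Nprime := (nat *l bool)%type.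

Definition absN (x : Nprime) : nat := x.1.+1.
Definition primed (x : Nprime) : bool := ~~ x.2.

Definition QSST (r : nat) (lam : 'I_r -> nat) : set (ST lam Nprime) :=
  [set m : ST lam Nprime | [/\
     (forall c d, row_of c = row_of d -> (col_of c <= col_of d)%N -> (m c <= m d)%O),
     (forall c d, col_of c = col_of d -> (row_of c <= row_of d)%N -> (m c <= m d)%O),
     (forall c d, row_of c = row_of d -> primed (m c) -> m c = m d -> c = d) &
     (forall c d, col_of c = col_of d -> ~~ primed (m c) -> m c = m d -> c = d)]].

Definition cexp (R : realType) (z : R[i]) : R[i] :=
  (expR (complex.Re z))%:C%C
    * (cos (complex.Im z) +i* sin (complex.Im z))%C.

(* n ^ s for n > 0, with the real logarithm of n *)
Definition npow (R : realType) (n : nat) (s : R[i]) : R[i] := cexp (s * (ln n%:R)%:C%C).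

Definition abs_summable (R : realType) (T : choiceType) (D : set T) (f : T -> R[i]) : Prop :=
  summable D (fun x => (complex.Re `|f x|)%:E).

Definition esum_real (R : realType) (T : choiceType) (D : set T)
    (f : T -> R) : R :=
  fine (\esum_(x in D) (Num.max (f x) 0)%:E)
    - fine (\esum_(x in D) (Num.max (- f x) 0)%:E).

(* Unordered sum over D, taken on real and imaginary parts, each split into its
   positive and negative parts; this is only the sum of the family when
   abs_summable D f holds (all four esums are then finite). *)
Definition csum (R : realType) (T : choiceType) (D : set T)
    (f : T -> R[i]) : R[i] :=
  (esum_real D (fun x => complex.Re (f x))
   +i* esum_real D (fun x => complex.Im (f x)))%C.

Definition zetaQ_term (R : realType) (r : nat) (lam : 'I_r -> nat) (s : ST lam R[i])
    (m : ST lam Nprime) : R[i] :=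
  \prod_(c : cell lam) npow (absN (m c)) (- s c).

Definition zetaQ (R : realType) (r : nat) (lam : 'I_r -> nat) (s : ST lam R[i]) : R[i] :=
  csum (@QSST r lam) (zetaQ_term s).

Definition zetaQ_abs_cvg (R : realType) (r : nat) (lam : 'I_r -> nat) (s : ST lam R[i]) : Prop :=
  abs_summable (@QSST r lam) (zetaQ_term s).

Definition pair_rows (r : nat) (i j : 'I_r) (k : 'I_2) : 'I_r :=
  if k == ord0 then i else j.

(* The shape lam \o pair_rows i j is (lam_i, lam_j). *)
Definition pair_tableau (r : nat) (lam : 'I_r -> nat) (X : Type) (s : ST lam X)
    (i j : 'I_r) : ST (lam \o pair_rows i j) X :=
  [ffun c => s (Tagged (fun k => 'I_(lam k)) (tagged c))].

Lemma double_ltn (n : nat) (i : 'I_n) : (i.*2 < n.*2)%N.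
Proof. by rewrite ltn_double. Qed.

Lemma doubleS_ltn (n : nat) (i : 'I_n) : (i.*2.+1 < n.*2)%N.
Proof. by rewrite ltn_Sdouble. Qed.

(* The positions 2i - 1 and 2i, counted from 1, for i = 1, ..., n. *)
Definition ord_fst (n : nat) (i : 'I_n) : 'I_(n.*2) := Ordinal (double_ltn i).
Definition ord_snd (n : nat) (i : 'I_n) : 'I_(n.*2) := Ordinal (doubleS_ltn i).

Definition matchings (n : nat) : {set 'S_(n.*2)} :=
  [set p : 'S_(n.*2) |
     [forall i : 'I_n, forall j : 'I_n,
        (i < j)%N ==> (p (ord_fst i) < p (ord_fst j))%N]
     && [forall i : 'I_n, (p (ord_fst i) < p (ord_snd i))%N]].

Definition pf (K : comNzRingType) (n : nat) (A : 'M[K]_(n.*2)) : K :=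
  \sum_(p in matchings n)
    (-1) ^+ odd_perm p * \prod_(i < n) A (p (ord_fst i)) (p (ord_snd i)).

Definition Mlam (R : realType) (r : nat) (lam : 'I_r -> nat)
    (s : ST lam R[i]) : 'M[R[i]]_r :=
  \matrix_(i, j) if (i < j)%N then zetaQ (pair_tableau s i j) else 0.

(* Main.v *)
Require Import Defs.
From mathcomp Require Import all_boot all_order all_algebra all_fingroup.
From mathcomp Require Import all_classical all_reals all_analysis.
From mathcomp Require Import complex zify ring lra.

(** Write 0, 1, 2, 3, ... for the letters 1' < 1 < 2' < 2 < ..., so that the
    primed letters are the even ones.  Erasing all cells that carry the largest
    letter of a tableau leaves a tableau of smaller shifted shape, so a tableau
    is a chain of strict shapes, one for each letter.  The length of one row
    along this chain is a lattice path, which dies when the row is empty, and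
    the tableau is a family of nonintersecting paths with free endpoints.  As
    [s] is constant on diagonals, the weight of a cell depends on its letter and
    on its content only; hence all rows move by the same one-letter transition
    matrix [T_l], and such families are counted by a Pfaffian.

    This is proved by induction on the number of letters.  The state of a row is
    its length, or, for an empty row, the letter at which it died; states are
    ordered so that rows further down are in smaller states.  On the states
    there is a skew form [A_l] ([pair_form]): [A_0] is the sign of the order
    between dead states and vanishes on living ones, and
    [A_(l+1) = T_l A_l T_l^T].  The claim ([tab_sum_pf]) is that the weighted sum of
    the tableaux with letters below [l] is the Pfaffian of [A_l] on the states of
    the rows.
    - For [l = 0] there is a tableau only if all rows are dead, and the Pfaffian
      of the strictly upper triangular all-ones matrix is 1 ([pf_ones]).
    - For the step, the Pfaffian is multilinear in the vectors of a Gram matrix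
      ([pf_gram]), which gives a sum over all families of new states.  For an
      unprimed letter, a multiple of each row vector is first subtracted from the
      vector of the row above ([pf_rowop]): this removes the steps that
      would bring a row down to the old length of the next row or below.  In the
      remaining families the states are weakly decreasing, and a family with two equal
      states contributes zero ([pf_repeat]).  What is left are the
      shapes that can remain after erasing the letter [l] ([pf_form_step],
      [tab_sum_step]).

    For two rows the claim says that the entries of [A_l] are the truncated
    two-row sums; hence every truncation of the zeta function is the Pfaffian of
    the truncated two-row functions.  A Pfaffian is a polynomial in its entries
    and absolutely convergent sums are the limits of their truncations
    ([csum_cvg]), so the formula follows in the limit.

    The rules for Pfaffians come from the sum over the whole symmetric group,
    where relabelling is a change of variables.  For a skew matrix this sum is a
    nonzero multiple of the Pfaffian ([sum_pf_term]). *)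

Set Implicit Arguments.
Unset Strict Implicit.
Unset Printing Implicit Defensive.

Import Order.TTheory GRing.Theory Num.Theory.

Local Open Scope ring_scope.

(** * Perfect matchings and their block symmetries *)

Section Positions.
Variable n : nat.
Implicit Types (i j : 'I_n) (x : 'I_(n.*2)).

Definition ord_half x : 'I_n := Ordinal (etrans (ltn_half_double x n) (ltn_ord x)).

Lemma ord_halfK x :
  (if odd x then ord_snd (ord_half x) else ord_fst (ord_half x)) = x.
Proof. by apply: val_inj; have := odd_double_half x; case: (odd x). Qed.

Lemma ord_fst_half i : ord_half (ord_fst i) = i.
Proof. by apply: val_inj; rewrite /= doubleK. Qed.

Lemma ord_snd_half i : ord_half (ord_snd i) = i.
Proof. by apply: val_inj; rewrite /= uphalf_double. Qed.

Lemma odd_ord_fst i : odd (ord_fst i) = false.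
Proof. by rewrite /= odd_double. Qed.

Lemma odd_ord_snd i : odd (ord_snd i) = true.
Proof. by rewrite /= odd_double. Qed.

Definition halfE := (ord_fst_half, ord_snd_half, odd_ord_fst, odd_ord_snd).

Lemma ord_fst_inj : injective (@ord_fst n).
Proof. by move=> i j /(congr1 ord_half); rewrite !halfE. Qed.

Lemma ord_snd_inj : injective (@ord_snd n).
Proof. by move=> i j /(congr1 ord_half); rewrite !halfE. Qed.

Lemma eq_ord_fst i j : (ord_fst i == ord_fst j) = (i == j).
Proof. exact: (inj_eq ord_fst_inj). Qed.

Lemma eq_ord_snd i j : (ord_snd i == ord_snd j) = (i == j).
Proof. exact: (inj_eq ord_snd_inj). Qed.

Lemma eq_fst_snd i j : (ord_fst i == ord_snd j) = false.
Proof. by apply/negP => /eqP /(congr1 (fun x : 'I__ => odd x)); rewrite !halfE. Qed.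

Lemma eq_snd_fst i j : (ord_snd i == ord_fst j) = false.
Proof. by rewrite eq_sym eq_fst_snd. Qed.

Definition eq_blockE := (eq_ord_fst, eq_ord_snd, eq_fst_snd, eq_snd_fst).

Lemma prod_pairs (K : comPzRingType) (F : 'I_(n.*2) -> K) :
  \prod_x F x = \prod_i (F (ord_fst i) * F (ord_snd i)).
Proof.
pose pos (u : 'I_n * bool) := if u.2 then ord_snd u.1 else ord_fst u.1.
rewrite (reindex pos) /=; last first.
  exists (fun x => (ord_half x, odd x)) => [[i []]|x] _;
    rewrite /pos /= ?halfE //.
  exact: ord_halfK.
transitivity (\prod_i \prod_(b : bool) F (pos (i, b))).
  by rewrite pair_bigA /=; apply: eq_bigr => -[].
by apply: eq_bigr => i _; rewrite big_bool mulrC.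
Qed.

(** A permutation [p] is read as the list of blocks [{p (2i), p (2i + 1)}]; the
    symmetries of the positions that respect the blocks are those commuting with
    [mate]. *)
Definition mate x : 'I_(n.*2) :=
  if odd x then ord_fst (ord_half x) else ord_snd (ord_half x).

Lemma mate_fst i : mate (ord_fst i) = ord_snd i.
Proof. by rewrite /mate !halfE. Qed.

Lemma mate_snd i : mate (ord_snd i) = ord_fst i.
Proof. by rewrite /mate !halfE. Qed.

Lemma mateK : involutive mate.
Proof.
move=> x; rewrite -[x in RHS]ord_halfK /mate.
by case: (odd x); rewrite !halfE.
Qed.

Definition mate_perm : 'S_(n.*2) := perm (can_inj mateK).

Lemma mate_permE x : mate_perm x = mate x.
Proof. exact: permE. Qed.

Definition block_flip i : 'S_(n.*2) := tperm (ord_fst i) (ord_snd i).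
Definition block_swap i j : 'S_(n.*2) :=
  (tperm (ord_fst i) (ord_fst j) * tperm (ord_snd i) (ord_snd j))%g.

(** This is the hyperoctahedral group.  It is given by generators because the
    invariance of a Pfaffian term is immediate for a flip and for a swap, whereas
    the sign of a general element would have to be computed. *)
Definition block_group : {group 'S_(n.*2)} :=
  <<[set block_flip i | i : 'I_n] :|:
    [set block_swap u.1 u.2 | u : 'I_n * 'I_n]>>%G.

Lemma block_flip_in i : block_flip i \in block_group.
Proof. by rewrite mem_gen // inE imset_f. Qed.

Lemma block_swap_in i j : block_swap i j \in block_group.
Proof.
rewrite mem_gen // inE; apply/orP; right.
exact: (imset_f (fun u => block_swap u.1 u.2) (_ : (i, j) \in _)).
Qed.

Lemma block_swap_fst i j k : block_swap i j (ord_fst k) = ord_fst (tperm i j k).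
Proof.
rewrite permM; case: (tpermP i j k) => [->|->|/eqP ki /eqP kj].
- by rewrite tpermL tpermD // eq_blockE.
- by rewrite tpermR tpermD // eq_blockE.
by rewrite !tpermD // eq_blockE // eq_sym.
Qed.

Lemma block_swap_snd i j k : block_swap i j (ord_snd k) = ord_snd (tperm i j k).
Proof.
rewrite permM; case: (tpermP i j k) => [->|->|/eqP ki /eqP kj].
- by rewrite (@tpermD _ (ord_fst i)) ?eq_blockE // tpermL.
- by rewrite (@tpermD _ (ord_fst i)) ?eq_blockE // tpermR.
by rewrite !tpermD // eq_blockE // eq_sym.
Qed.

Lemma block_flip_other i k : k != i ->
  (block_flip i (ord_fst k) = ord_fst k) * (block_flip i (ord_snd k) = ord_snd k).
Proof. by move=> ki; rewrite !tpermD // eq_blockE // eq_sym. Qed.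

(** Both kinds of generators commute with [mate]; this is all that uniqueness of
    the matching in a coset needs. *)
Lemma block_group_mate h x : h \in block_group -> h (mate x) = mate (h x).
Proof.
suff /fintype.subsetP sub : block_group \subset 'C[mate_perm]%g.
  by move=> /sub /cent1P /permP /(_ x); rewrite !permM !mate_permE.
rewrite gen_subG; apply/fintype.subsetP => g; rewrite inE => /orP[] /imsetP[].
  move=> i _ ->; apply/cent1P/permP => y; rewrite !permM !mate_permE.
  rewrite -[y]ord_halfK; case: (odd y); rewrite ?mate_fst ?mate_snd;
    (case: (eqVneq (ord_half y) i) => [->|ki];
      [by rewrite ?tpermL ?tpermR ?mate_fst ?mate_snd
      |by rewrite !(block_flip_other ki) ?mate_fst ?mate_snd]).
move=> [i j] _ ->; apply/cent1P/permP => y; rewrite [LHS]permM [RHS]permM !mate_permE /=.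
rewrite -[y]ord_halfK; case: (odd y); rewrite ?mate_fst ?mate_snd;
  by rewrite ?block_swap_fst ?block_swap_snd ?mate_fst ?mate_snd.
Qed.

End Positions.

(** An increasing self-map of ['I_n] satisfies [j <= f j] by induction from below
    and [f j <= j] by induction from above. *)
Lemma increasing_ord_id n (f : 'I_n -> 'I_n) :
  (forall i j : 'I_n, (i < j)%N -> (f i < f j)%N) -> forall i, f i = i.
Proof.
move=> fS i; apply/val_inj/eqP; rewrite eqn_leq; apply/andP; split.
  suff H k : forall j : 'I_n, (n - j = k)%N -> (f j <= j)%N by exact: (H _ i erefl).
  elim: k => [|k IH] j jk; first by have := ltn_ord j; lia.
  have [jn|jn] := ltnP j.+1 n; last by have := ltn_ord (f j); lia.
  have := IH (Ordinal jn); rewrite /= => /(_ ltac:(lia)).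
  by have := fS j (Ordinal jn) (ltnSn j); lia.
suff H k : forall j : 'I_n, (j = k :> nat)%N -> (j <= f j)%N by exact: (H _ i erefl).
elim: k => [|k IH] j jk; first by rewrite jk.
have kn : (k < n)%N by have := ltn_ord j; lia.
have := IH (Ordinal kn) erefl; have := fS (Ordinal kn) j; rewrite /=; lia.
Qed.

Section Matchings.
Variable n : nat.
Implicit Types (p q h : 'S_(n.*2)).

Lemma matchingsP p :
  reflect ((forall i j : 'I_n, (i < j)%N -> (p (ord_fst i) < p (ord_fst j))%N)
           /\ (forall i, (p (ord_fst i) < p (ord_snd i))%N))
          (p \in matchings n).
Proof.
rewrite inE; apply: (iffP andP) => -[H1 H2]; split.
- by move=> i j; move/forallP: H1 => /(_ i) /forallP /(_ j) /implyP; apply.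
- by move=> i; move/forallP: H2.
- by apply/forallP => i; apply/forallP => j; apply/implyP; exact: H1.
- exact/forallP.
Qed.

(** If [h] reversed a block, one of [p] and [h * p] would have that block in the
    wrong order.  So [h] permutes the first positions, increasingly since [p]
    and [h * p] both list the first points in increasing order. *)
Lemma matching_rep_uniq p h :
  p \in matchings n -> (h * p)%g \in matchings n -> h \in block_group n -> h = 1%g.
Proof.
move=> /matchingsP[p1 p2] /matchingsP[q1 q2] hH.
have hf i : h (ord_fst i) = ord_fst (ord_half (h (ord_fst i))).
  have := ord_halfK (h (ord_fst i)).
  case: ifP => // _; set j := ord_half _ => hj.
  have := q2 i; rewrite !permM -(mate_fst i) block_group_mate // -hj mate_snd.
  by have := p2 j; lia.
have pi_inc (i j : 'I_n) : (i < j)%N ->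
    (ord_half (h (ord_fst i)) < ord_half (h (ord_fst j)))%N.
  move=> /q1; rewrite !permM hf [h (ord_fst j)]hf !halfE.
  set a := ord_half _; set b := ord_half _ => pab.
  rewrite ltnNge leq_eqVlt; apply/negP => /orP[/eqP/val_inj ba|/p1]; last lia.
  by move: pab; rewrite ba; lia.
have hfi i : h (ord_fst i) = ord_fst i by rewrite hf (increasing_ord_id pi_inc).
apply/permP => x; rewrite perm1 -[x]ord_halfK; case: (odd x) => //.
by rewrite -mate_fst block_group_mate // hfi.
Qed.

(** Choose [h] so that the sum of the first points of the blocks, with decreasing
    weights, is minimal: swapping a block or two blocks that are in the wrong
    order would make it smaller. *)
Lemma matching_rep_exists q :
  exists2 h, h \in block_group n & (h * q)%g \in matchings n.
Proof.
pose w h : nat := (\sum_(i < n) (n - i) * q (h (ord_fst i)))%N.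
case: (arg_minnP (i0 := 1%g) w (group1 (block_group n))) => h hH hmin.
exists h => //.
have w2 (i j : 'I_n) (h' : 'S_(n.*2)) : i != j ->
    (forall k, k != i -> k != j -> h' (ord_fst k) = h (ord_fst k)) ->
    h' \in block_group n ->
    ((n - i) * q (h (ord_fst i)) + (n - j) * q (h (ord_fst j)) <=
     (n - i) * q (h' (ord_fst i)) + (n - j) * q (h' (ord_fst j)))%N.
  move=> ij hE h'H; have := hmin _ h'H; rewrite /w.
  rewrite (bigD1 i) //= (bigD1 j) ?(eq_sym j) //= addnA.
  rewrite (bigD1 i (F := fun k : 'I_n => ((n - k) * q (h' _))%N)) //=.
  rewrite (bigD1 j (F := fun k : 'I_n => ((n - k) * q (h' _))%N)) ?(eq_sym j) //= addnA.
  rewrite [X in (_ + X <= _)%N -> _](eq_bigr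
    (fun k : 'I_n => ((n - k) * q (h' (ord_fst k)))%N)).
    by rewrite leq_add2r.
  by move=> k /andP[ki kj]; rewrite hE.
have qh_inj x y : val (q (h x)) = q (h y) -> x = y.
  by move=> /val_inj /perm_inj /perm_inj.
apply/matchingsP; split=> [i j ij|i]; rewrite !permM ltnNge.
  apply/negP => le_ji; have nij : i != j by rewrite neq_ltn ij.
  have bsM x : (block_swap i j * h)%g x = h (block_swap i j x) by exact: permM.
  have := w2 i j (block_swap i j * h)%g nij.
  rewrite !bsM !block_swap_fst tpermL tpermR.
  have swE k : k != i -> k != j -> (block_swap i j * h)%g (ord_fst k) = h (ord_fst k).
    by move=> ki kj; rewrite bsM block_swap_fst tpermD // eq_sym.
  move=> /(_ swE (groupM (block_swap_in i j) hH)).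
  have : q (h (ord_fst j)) != q (h (ord_fst i)) :> nat.
    by apply/eqP => /qh_inj /ord_fst_inj ji; move: nij; rewrite ji eqxx.
  by have := ltn_ord j; move: ij le_ji; clear; nia.
apply/negP => le_si.
have := hmin (block_flip i * h)%g (groupM (block_flip_in i) hH); rewrite /w.
rewrite (bigD1 i) //= (bigD1 i (F := fun k : 'I_n => ((n - k) * q ((_ * h)%g _))%N)) //=.
rewrite permM /block_flip tpermL.
rewrite [X in (_ <= _ + X)%N -> _](eq_bigr
  (fun k : 'I_n => ((n - k) * q (h (ord_fst k)))%N)); last first.
  by move=> k ki; rewrite permM (block_flip_other ki).
rewrite leq_add2r leq_pmul2l ?subn_gt0 // => le_is.
have : val (q (h (ord_fst i))) = q (h (ord_snd i)).
  by apply/eqP; rewrite eqn_leq; apply/andP; split.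
by move=> /qh_inj /eqP; rewrite eq_blockE.
Qed.

End Matchings.

(** * Pfaffians of skew matrices *)

Section FullSum.
Variables (K : comNzRingType) (n : nat).
Implicit Types (A B : 'M[K]_(n.*2)) (p h : 'S_(n.*2)).

Definition skew r (A : 'M[K]_r) := forall i j, A j i = - A i j.

Definition pf_term A p : K :=
  (-1) ^+ odd_perm p * \prod_(i < n) A (p (ord_fst i)) (p (ord_snd i)).

Lemma pf_term_flip A i p : skew A ->
  pf_term A (block_flip i * p)%g = pf_term A p.
Proof.
move=> skA; rewrite /pf_term odd_mul_tperm eq_blockE.
rewrite addTb signrN mulNr -mulrN; congr (_ * _).
rewrite (bigD1 i) //= [in RHS](bigD1 i) //= -mulNr -skA.
rewrite !permM /block_flip tpermL tpermR; congr (_ * _).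
by apply: eq_bigr => k ki; rewrite !permM !(block_flip_other ki).
Qed.

Lemma pf_term_swap A i j p : pf_term A (block_swap i j * p)%g = pf_term A p.
Proof.
rewrite /pf_term !odd_permM !odd_tperm !eq_blockE addbb addFb; congr (_ * _).
rewrite [RHS](reindex_inj (@perm_inj _ (tperm i j))) /=; apply: eq_bigr => k _.
by rewrite ![(_ * p)%g _]permM block_swap_fst block_swap_snd.
Qed.

(** The permutations that leave all terms unchanged form a group, so it is enough
    to look at the generators. *)
Lemma pf_term_block A h p : skew A -> h \in block_group n ->
  pf_term A (h * p)%g = pf_term A p.
Proof.
move=> skA.
pose S := [set h | [forall p, pf_term A (h * p)%g == pf_term A p]].
have SP g : reflect (forall p, pf_term A (g * p)%g = pf_term A p) (g \in S).
  by rewrite inE; apply: (iffP forallP) => H q; apply/eqP.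
have gS : group_set S.
  apply/group_setP; split=> [|x y /SP Sx /SP Sy]; apply/SP => q.
    by rewrite mul1g.
  by rewrite -mulgA Sx Sy.
suff /fintype.subsetP sub : block_group n \subset group gS by move=> /sub /SP.
rewrite gen_subG; apply/fintype.subsetP => g; rewrite inE => /orP[] /imsetP[].
  by move=> i _ ->; apply/SP => q; exact: pf_term_flip.
by move=> [i j] _ ->; apply/SP => q; exact: pf_term_swap.
Qed.

(** The matchings form a transversal of the right cosets of [block_group], on
    which the term of a skew matrix is constant. *)
Lemma sum_pf_term A : skew A ->
  \sum_p pf_term A p = #|block_group n|%:R * pf A.
Proof.
move=> skA; pose H := block_group n.
pose rep q := odflt q [pick p in matchings n | p \in (H :* q)%g].
have repP q : (rep q \in matchings n) && (rep q \in (H :* q)%g).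
  rewrite /rep; case: pickP => [p //|none].
  have [h hH hM] := matching_rep_exists q.
  by have := none (h * q)%g; rewrite hM mem_rcoset mulgK hH.
rewrite (partition_big rep (mem (matchings n))) /=; last first.
  by move=> q _; case/andP: (repP q).
rewrite mulr_sumr; apply: eq_bigr => p pM.
transitivity (\sum_(q in (H :* p)%g) pf_term A p); last first.
  by rewrite sumr_const card_rcoset mulr_natl.
apply: eq_big => [q|q /eqP repq].
  apply/eqP/rcosetP => [<-|[h hH ->]].
    have /andP[_ /rcosetP[h hH ->]] := repP q.
    by exists h^-1%g; rewrite ?groupV // mulKg.
  have /andP[rM /rcosetP[g gH rE]] := repP (h * p)%g.
  rewrite mulgA in rE; have ghH : (g * h)%g \in H by rewrite groupM.
  move: rM; rewrite rE => rM.
  by rewrite (matching_rep_uniq pM rM ghH) mul1g.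
have /andP[_ /rcosetP[h hH rE]] := repP q.
by rewrite -repq rE pf_term_block.
Qed.

Lemma pf_eq_upper A B :
  (forall i j : 'I_(n.*2), (i < j)%N -> A i j = B i j) -> pf A = pf B.
Proof.
move=> AB; apply: eq_bigr => p /matchingsP[_ ps]; congr (_ * _).
by apply: eq_bigr => i _; apply: AB.
Qed.

(** Every perfect matching covers the point [i]. *)
Lemma pf_row0 A i : (forall j, A i j = 0) -> (forall j, A j i = 0) -> pf A = 0.
Proof.
move=> Ai0 A0i; rewrite /pf big1 // => p _.
have [x px] : exists x, p x = i by exists (p^-1 i)%g; rewrite permKV.
rewrite (bigD1 (ord_half x)) //=.
set u := ord_half x.
suff -> : A (p (ord_fst u)) (p (ord_snd u)) = 0 by rewrite mul0r mulr0.
by move: px; rewrite -(ord_halfK x) -/u; case: (odd x) => ->.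
Qed.

(** Distributivity: choosing a pair of indices for each block is choosing one
    index for each point. *)
Lemma prod_sum_pairs (C : finType) (V : 'I_(n.*2) -> C -> K) (A : C -> C -> K) p :
  \prod_(i < n) (\sum_c \sum_d
     V (p (ord_fst i)) c * V (p (ord_snd i)) d * A c d) =
  \sum_(h : {ffun 'I_(n.*2) -> C}) (\prod_x V x (h x)) *
     \prod_(i < n) A (h (p (ord_fst i))) (h (p (ord_snd i))).
Proof.
under eq_bigr do rewrite pair_bigA /=.
rewrite bigA_distr_bigA /=.
pose enc (h : {ffun 'I_(n.*2) -> C}) : {ffun 'I_n -> C * C} :=
  [ffun i => (h (p (ord_fst i)), h (p (ord_snd i)))].
pose dec (f : {ffun 'I_n -> C * C}) : {ffun 'I_(n.*2) -> C} :=
  [ffun x => let y := (p^-1)%g x in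
     if odd y then (f (ord_half y)).2 else (f (ord_half y)).1].
rewrite (reindex enc) /=; last first.
  exists dec => [h|f] _; apply/ffunP => x; rewrite !ffunE /=.
    have := ord_halfK ((p^-1)%g x).
    by case: (odd _) => E; rewrite !ffunE /= E permKV.
  by rewrite !permK !halfE; case: (f x).
apply: eq_bigr => h _; rewrite (reindex_inj (@perm_inj _ p)) /= prod_pairs.
by rewrite -big_split /=; apply: eq_bigr => i _; rewrite !ffunE.
Qed.

(** The Pfaffian of a Gram matrix is multilinear in its vectors. *)
Lemma pf_gram (C : finType) (V : 'I_(n.*2) -> C -> K) (A : C -> C -> K) :
  pf (\matrix_(i, j) \sum_c \sum_d V i c * V j d * A c d) =
  \sum_(h : {ffun 'I_(n.*2) -> C}) (\prod_x V x (h x)) *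
     pf (\matrix_(i, j) A (h i) (h j)).
Proof.
transitivity (\sum_(p in matchings n) \sum_(h : {ffun 'I_(n.*2) -> C})
   (\prod_x V x (h x)) * pf_term (\matrix_(i, j) A (h i) (h j)) p).
  apply: eq_bigr => p _; under [X in _ * X]eq_bigr do rewrite mxE.
  rewrite prod_sum_pairs mulr_sumr; apply: eq_bigr => h _.
  by rewrite mulrCA; congr (_ * (_ * _)); apply: eq_bigr => i _; rewrite mxE.
by rewrite exchange_big; apply: eq_bigr => h _; rewrite -mulr_sumr.
Qed.

End FullSum.

Section SkewPfaffian.
Variables (K : numDomainType) (n : nat).
Implicit Types (B : 'M[K]_(n.*2)).

Lemma block_group_neq0 : #|block_group n|%:R != 0 :> K.
Proof. by rewrite pnatr_eq0 -lt0n cardG_gt0. Qed.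

(** Clear for the sum over all permutations, where [p] becomes [p * s]; over
    matchings only, the blocks would have to be sorted again. *)
Lemma pf_perm B (s : 'S_(n.*2)) : skew B ->
  pf (\matrix_(i, j) B (s i) (s j)) = (-1) ^+ odd_perm s * pf B.
Proof.
move=> skB; apply: (mulfI block_group_neq0).
rewrite mulrCA -!sum_pf_term //; last by move=> i j; rewrite !mxE skB.
rewrite mulr_sumr [RHS](reindex_inj (mulIg s)) /=.
apply: eq_bigr => p _; rewrite /pf_term odd_permM signr_addb.
rewrite [in RHS]mulrA [(-1) ^+ odd_perm s * _]mulrCA -signr_addb addbb mulr1.
by congr (_ * _); apply: eq_bigr => i _; rewrite mxE !permM.
Qed.

(** Exchanging the two equal indices changes the sign but not the matrix. *)
Lemma pf_repeat (C : Type) (A : C -> C -> K) (h : 'I_(n.*2) -> C) i j :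
  (forall c d, A d c = - A c d) -> i != j -> h i = h j ->
  pf (\matrix_(k, l) A (h k) (h l)) = 0.
Proof.
move=> skA ij hij; set B := \matrix_(k, l) _.
have skB : skew B by move=> k l; rewrite !mxE skA.
have := pf_perm (tperm i j) skB; rewrite odd_tperm ij expr1 mulN1r.
suff -> : (\matrix_(k, l) B (tperm i j k) (tperm i j l)) = B.
  by move/eqP; rewrite -addr_eq0 -mulr2n mulrn_eq0 => /eqP.
have ht k : h (tperm i j k) = h k by case: tpermP => // ->.
by apply/matrixP => k l; rewrite !mxE !ht.
Qed.

(** Expanding [P B P^T] by multilinearity gives a sum over all index maps [h];
    those that are not injective vanish, and the permutations give the Leibniz
    formula for the determinant of [P]. *)
Lemma pf_congr (P B : 'M[K]_(n.*2)) : skew B ->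
  pf (P *m B *m P^T) = \det P * pf B.
Proof.
move=> skB.
have -> : P *m B *m P^T = \matrix_(i, j) \sum_c \sum_d P i c * P j d * B c d.
  apply/matrixP => i j; rewrite !mxE exchange_big /=; apply: eq_bigr => d _.
  rewrite !mxE mulr_suml; apply: eq_bigr => c _.
  by rewrite mulrAC.
rewrite pf_gram.
rewrite (bigID (fun h : {ffun 'I_(n.*2) -> 'I_(n.*2)} => injectiveb h)) /=.
rewrite [X in _ + X]big1 ?addr0; last first.
  move=> h /injectivePn[i [j ij hij]].
  by rewrite (pf_repeat skB ij hij) mulr0.
rewrite (reindex (fun s : 'S_(n.*2) => pval s)) /=; last first.
  have s0 : 'S_(n.*2) := 1%g.
  exists (insubd s0) => [s|h] hI.
    by apply/permP => x; rewrite valKd.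
  exact: insubdK.
rewrite mulr_suml; apply: eq_big => [s|s _]; first by rewrite (valP s).
by rewrite pvalE pf_perm // mulrA [_ * (-1) ^+ _]mulrC.
Qed.

(** Adding to each row and column a multiple of the following one leaves the
    Pfaffian unchanged, the transformation being unitriangular. *)
Lemma pf_rowop (B : nat -> nat -> K) (k : nat -> K) :
  (forall i j, B j i = - B i j) -> k n.*2.-1 = 0 ->
  pf (\matrix_(i, j) B i j : 'M[K]_(n.*2)) =
  pf (\matrix_(i, j) (B i j - k i * B i.+1 j
        - k j * (B i j.+1 - k i * B i.+1 j.+1)) : 'M[K]_(n.*2)).
Proof.
move=> skB k0; set M := \matrix_(i, j) B i j.
have skM : skew M by move=> i j; rewrite !mxE skB.
pose P : 'M[K]_(n.*2) := \matrix_(i, j) ((i == j)%:R - k i * (j == i.+1 :> nat)%:R).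
have detP : \det P = 1.
  rewrite -det_tr det_trig.
    by rewrite big1 // => i _; rewrite !mxE eqxx (ltn_eqF (ltnSn i)) mulr0 subr0.
  apply/is_trig_mxP => i j ij; rewrite !mxE.
  have -> : (j == i) = false by apply/eqP => ji; move: ij; rewrite ji ltnn.
  by rewrite (_ : (_ == _) = false) ?mulr0 ?subr0 //; apply/eqP; lia.
have sumP i (F : nat -> K) : \sum_j P i j * F j = F i - k i * F i.+1.
  under eq_bigr do rewrite mxE mulrBl.
  rewrite sumrB; congr (_ - _).
    rewrite (bigD1 i) //= eqxx mul1r big1 ?addr0 // => j ji.
    by rewrite eq_sym (negbTE ji) mul0r.
  have [i1|i1] := ltnP i.+1 n.*2.
    rewrite (bigD1 (Ordinal i1)) //= eqxx mulr1 big1 ?addr0 // => j ji.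
    rewrite (_ : (_ == _) = false) ?mulr0 ?mul0r //; apply/eqP => ji1.
    by case/eqP: ji; apply: val_inj.
  have -> : k i = 0 by rewrite -k0; congr k; have := ltn_ord i; lia.
  by rewrite mul0r big1 // => j _; rewrite !mul0r.
rewrite -[pf M]mul1r -detP -pf_congr //; congr pf.
apply/matrixP => i j; rewrite !mxE.
have PM x : (P *m M) i x = B i x - k i * B i.+1 x.
  rewrite mxE -(sumP i (fun y => B y x)).
  by apply: eq_bigr => y _; rewrite [M _ _]mxE.
under eq_bigr do rewrite PM [X in _ * X]mxE mulrC.
exact: (sumP j (fun x => B i x - k i * B i.+1 x)).
Qed.

(** Subtracting row [2i + 1] from row [2i] turns the strictly upper triangular
    all-ones matrix into one whose only perfect matching is [{2i, 2i + 1}]. *)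
Lemma pf_ones : pf (\matrix_(i, j) (i < j)%N%:R : 'M[K]_(n.*2)) = 1.
Proof.
pose B (i j : nat) : K := (i < j)%N%:R - (j < i)%N%:R.
rewrite (@pf_eq_upper _ _ _ (\matrix_(i, j) B i j)); last first.
  by move=> i j ij; rewrite !mxE /B ij ltnNge ltnW // subr0.
have skB i j : B j i = - B i j by rewrite opprB.
pose k i : K := (~~ odd i && (i < n.*2.-1)%N)%:R.
rewrite (@pf_rowop B k) //; last by rewrite /k ltnn andbF.
set C := \matrix_(i, j) _.
have skC : skew C by move=> i j; rewrite !mxE !(skB j) !(skB j.+1); ring.
have kfst (i : 'I_n) : k (ord_fst i) = 1.
  by rewrite /k odd_ord_fst /= (_ : (_ < _)%N) //; have := ltn_ord i; lia.
have ksnd (i : 'I_n) : k (ord_snd i) = 0 by rewrite /k odd_ord_snd.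
have Blt i j : (i < j)%N -> B i j = 1 by rewrite /B => ij; rewrite ij ltnNge ltnW // subr0.
have Bgt i j : (j < i)%N -> B i j = - 1 by move=> ij; rewrite skB Blt.
have Beq i : B i i = 0 by rewrite /B ltnn subr0.
have Cff (i j : 'I_n) : C (ord_fst i) (ord_fst j) = 0.
  rewrite mxE !kfst /=; case: (ltngtP i j) => [ij|ij|->].
  - by rewrite !Blt; try lia; ring.
  - by rewrite !Bgt; try lia; ring.
  - by rewrite !Beq (Bgt _.+1) // Blt //; ring.
have Cfs (i j : 'I_n) : C (ord_fst i) (ord_snd j) = (i == j)%:R.
  rewrite mxE kfst ksnd mul0r /= -val_eqE /=; case: (ltngtP i j) => [ij|ij|->].
  - by rewrite !Blt; try lia; rewrite /=; ring.
  - by rewrite !Bgt; try lia; rewrite /=; ring.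
  - by rewrite Beq Blt //=; ring.
have M1 : 1%g \in matchings n.
  by apply/matchingsP; split=> [i j ij|i]; rewrite !perm1 /=; lia.
rewrite /pf (bigD1 1%g) //= odd_perm1 mul1r big1; last first.
  by move=> i _; rewrite !perm1 Cfs eqxx.
rewrite big1 ?addr0 // => p /andP[/matchingsP[p1 p2]].
apply: contraNeq; rewrite mulf_eq0 signr_eq0 /= => /prodf_neq0 Cn0.
have nz (i : 'I_n) : C (p (ord_fst i)) (p (ord_snd i)) != 0 by exact: Cn0.
(* In a nonzero term each even point opens its block. *)
have open_even a : exists i, p (ord_fst i) = ord_fst a.
  set x := (p^-1)%g (ord_fst a); exists (ord_half x).
  have px : p x = ord_fst a by rewrite permKV.
  have := ord_halfK x; case: ifP => [_ xE|_ -> //].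
  have := nz (ord_half x); have := p2 (ord_half x); rewrite xE px.
  rewrite -(ord_halfK (p (ord_fst (ord_half x)))); set b := ord_half (p _).
  case: (odd _) => /= [ba|_]; last by rewrite Cff eqxx.
  rewrite skC Cfs oppr_eq0 pnatr_eq0 eqb0 negbK => /eqP ab.
  by move: ba; rewrite ab ltnNge leqnSn.
pose g a := sval (cid (open_even a)).
have pg a : p (ord_fst (g a)) = ord_fst a by rewrite /g; case: cid.
have g_inj : injective g.
  by move=> a b /(congr1 (fun i => p (ord_fst i))); rewrite !pg => /ord_fst_inj.
have pf_even i : p (ord_fst i) = ord_fst (ord_half (p (ord_fst i))).
  by have /codomP[a ->] := injF_onto g_inj i; rewrite pg ord_fst_half.
have inc (i j : 'I_n) : (i < j)%N ->
    (ord_half (p (ord_fst i)) < ord_half (p (ord_fst j)))%N.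
  move=> /p1; rewrite [p (ord_fst i)]pf_even [p (ord_fst j)]pf_even /=.
  by rewrite ltn_double !doubleK.
have pfst i : p (ord_fst i) = ord_fst i by rewrite pf_even (increasing_ord_id inc).
apply/eqP/permP => x; rewrite perm1 -[x]ord_halfK; case: (odd x); last exact: pfst.
set i := ord_half x; have := nz i; rewrite pfst -[p _]ord_halfK.
case: (odd _); last by rewrite Cff eqxx.
by rewrite Cfs pnatr_eq0 eqb0 negbK => /eqP <-.
Qed.

End SkewPfaffian.

(** * Transfer of Pfaffians along one letter *)

(** States of rows are natural numbers.  With [N] letters in all, [N + h] is a
    living row of length [h > 0], [N - l] is a row that died at the letter [l],
    and [0] is a row that was empty from the start.  Letters are erased from the
    largest one down, and the rows die from the bottom up, so the state
    decreases strictly from each row to the next. *)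
Section Transfer.
Variables (K : numDomainType) (y : nat -> nat -> K) (N M : nat).

(** Truncated subtraction gives length [0] to all dead states. *)
Definition row_length c := (c - N)%N.

Definition reachable l c := ((N < c) || (c == N - l))%N.

(** A dead row keeps its state.  A living one loses some cells, all carrying the
    letter [l]; if [l] is primed, that is even, it loses at most one. *)
Definition step_ok l a c :=
  if (a <= N)%N then c == a
  else [&& reachable l c, (c <= a)%N & odd l || (row_length a <= (row_length c).+1)%N].

Definition step_weight l a c : K :=
  if step_ok l a c then \prod_(row_length c <= k < row_length a) y l k else 0.

(** [pair_form l] is the Gram matrix, after [l] letters, of the sign form on dead
    states; on the states of two rows it is the two-row sum of [tab_sum_pf]. *)
Fixpoint pair_form l a b : K :=
  if l is l'.+1 then
    \sum_(c < M) \sum_(d < M) step_weight l' a c * step_weight l' b d * pair_form l' c d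
  else if (a <= N)%N && (b <= N)%N then (b < a)%N%:R - (a < b)%N%:R else 0.

Lemma form_skew l a b : pair_form l b a = - pair_form l a b.
Proof.
elim: l a b => [|l IH] a b /=; first by rewrite andbC; case: ifP; rewrite ?opprB ?oppr0.
rewrite exchange_big -sumrN; apply: eq_bigr => c _.
rewrite -sumrN; apply: eq_bigr => d _.
by rewrite IH mulrN [step_weight l b d * _]mulrC.
Qed.

(** The states possible when the letters below [l] are still to be erased: no row
    has died at one of them. *)
Definition state_ok r l (f : 'I_r -> nat) :=
  (forall i j : 'I_r, (i < j)%N -> (f j < f i)%N)
  /\ (forall i, (f i <= N - l)%N \/ (N < f i)%N).

(** Two equal unprimed letters may not share a column, so when an unprimed letter
    is erased a row has to stay longer than the next row was before. *)
Definition row_peeling r l (f : 'I_r -> nat) (i : 'I_r) c :=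
  step_ok l (f i) c
  && (odd l ==> [forall j : 'I_r, ((i < j) && (N < f j) ==> (f j < c))%N]).

Definition peeling r l (f h : 'I_r -> nat) :=
  [forall i, row_peeling l f i (h i)]
  && [forall i : 'I_r, forall j : 'I_r, (i < j)%N ==> (h j < h i)%N].

(** The conditions on the separate rows nearly force the new states to
    decrease: for a primed letter the lengths drop by at most one, so two rows
    may meet but not cross, and a row that dies at [l] ends above all the rows
    that died earlier. *)
Lemma row_peeling_noninc r l (f h : 'I_r -> nat) : (l < N)%N -> state_ok l.+1 f ->
  (forall i, row_peeling l f i (h i)) ->
  forall i j : 'I_r, (i < j)%N -> (h j <= h i)%N.
Proof.
move=> lN [fdec fok] al i j ij; have fij := fdec _ _ ij.
have /andP[mi /implyP bi] := al i; have /andP[mj _] := al j.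
move: mi mj; rewrite /step_ok /reachable /row_length.
have [fiN|fiN] := leqP (f i) N.
  have -> : (f j <= N)%N by lia.
  by move=> /eqP -> /eqP ->; lia.
have := fok j; have [fjN|fjN] := leqP (f j) N; first by move=> ? /and3P[? ? ?] /eqP ->; lia.
move=> _ /and3P[li le_i wi] /and3P[lj le_j wj].
case/orP: wi => [/bi /forallP /(_ j)|wi]; last by lia.
by rewrite ij fjN /=; lia.
Qed.

Lemma peelingP r l (f h : 'I_r -> nat) :
  reflect ((forall i, row_peeling l f i (h i)) /\
           (forall i j : 'I_r, (i < j)%N -> (h j < h i)%N)) (peeling l f h).
Proof.
apply: (iffP andP) => -[]; last first.
  move=> al dec; split; first exact/forallP.
  by apply/forallP => i; apply/forallP => j; apply/implyP; exact: dec.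
move=> /forallP al /forallP dec; split=> // i j.
by move/forallP: (dec i) => /(_ j) /implyP.
Qed.

Lemma peeling_ok r l (f h : 'I_r -> nat) : (l < N)%N -> state_ok l.+1 f ->
  peeling l f h -> state_ok l h.
Proof.
move=> lN [fdec fok] /peelingP[al dec]; split=> // i.
have /andP[+ _] := al i; have := fok i; rewrite /step_ok /reachable.
have [fiN|fiN] := leqP (f i) N; first by move=> ? /eqP ->; lia.
by move=> _ /and3P[/orP[->|/eqP->] _ _]; [right|left].
Qed.

(** The steps of row [i] that pass the length of row [j] factor through that
    length, so subtracting a multiple of the vector of row [j] removes exactly
    these. *)
Lemma step_weight_sub r l (f : 'I_r -> nat) (i j : 'I_r) c : odd l ->
  (N < f j)%N -> (f j < f i)%N ->
  step_weight l (f i) c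
    - (\prod_(row_length (f j) <= k < row_length (f i)) y l k) * step_weight l (f j) c
  = if (f j < c)%N then step_weight l (f i) c else 0.
Proof.
move=> ol fjN fji.
rewrite /step_weight /step_ok !(leqNgt _ N) fjN (ltn_trans fjN fji) ol /= !andbT.
have [cj|cj] := ltnP (f j) c.
  by rewrite andbF mulr0 subr0.
rewrite (leq_trans cj (ltnW fji)) !andbT.
case: (reachable l c); last by rewrite mulr0 subr0.
rewrite [X in X - _](@big_cat_nat _ _ _ (row_length (f j))) /=;
  try by rewrite /row_length; lia.
by rewrite mulrC subrr.
Qed.

(** Row operations cut off the steps that end at or below the next row,
    multilinearity expands over the new states, and the families of states
    that are not strictly decreasing contain a repetition and vanish. *)
Lemma pf_form_step n l (f : 'I_(n.*2) -> nat) : (l < N)%N -> state_ok l.+1 f ->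
  pf (\matrix_(i, j) pair_form l.+1 (f i) (f j) : 'M[K]_(n.*2)) =
  \sum_(h : {ffun 'I_(n.*2) -> 'I_M} | peeling l f (fun i => h i))
    (\prod_i \prod_(row_length (h i) <= k < row_length (f i)) y l k) *
    pf (\matrix_(i, j) pair_form l (h i) (h j)).
Proof.
move=> lN fok; have [fdec fdead] := fok.
(* Past the last row the state is dead, so the last row is left unchanged. *)
pose fx i := if insub i is Some j then f j else 0%N.
have fxE (i : 'I_(n.*2)) : fx i = f i by rewrite /fx valK.
pose k i := if odd l && (N < fx i.+1)%N
  then \prod_(row_length (fx i.+1) <= k < row_length (fx i)) y l k else 0.
pose U (i : 'I_(n.*2)) (c : 'I_M) := if row_peeling l f i c
  then \prod_(row_length c <= k < row_length (f i)) y l k else 0.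
have UE i c : U i c = step_weight l (fx i) c - k i * step_weight l (fx i.+1) c.
  rewrite /k; case: ifPn => [/andP[ol fi1]|nb].
    have i1 : (i.+1 < n.*2)%N.
      by rewrite ltnNge; apply/negP => ge; move: fi1; rewrite /fx insubN // -leqNgt.
    have fi1E : fx i.+1 = f (Ordinal i1) by rewrite -fxE.
    rewrite fi1E in fi1 *; rewrite fxE step_weight_sub //; last exact: fdec.
    rewrite /U /row_peeling ol /= /step_weight; case: (step_ok _ _ _) => /=; last by case: ifP.
    congr (if _ then _ else _); apply/forallP/idP => [/(_ (Ordinal i1))|ic j].
      by rewrite fi1 /= ltnSn.
    apply/implyP => /andP[ij fj]; apply: leq_ltn_trans ic.
    have [<-|nj] := eqVneq (Ordinal i1) j; first exact: leqnn.
    apply/ltnW/fdec; rewrite /= ltn_neqAle ij andbT.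
    by apply: contra nj => /eqP ij1; apply/eqP/val_inj.
  rewrite mul0r subr0 fxE /U /step_weight /row_peeling; case: (step_ok _ _ _) => //=.
  rewrite (_ : _ ==> _) //; apply/implyP => ol; apply/forallP => j.
  apply/implyP => /andP[ij fj]; case/negP: nb; rewrite ol /=.
  have i1 : (i.+1 < n.*2)%N by exact: leq_ltn_trans ij (ltn_ord j).
  rewrite -[i.+1]/(val (Ordinal i1)) fxE.
  have [->//|nj] := eqVneq (Ordinal i1) j.
  apply: ltn_trans fj _; apply: fdec; rewrite /= ltn_neqAle ij andbT.
  by apply: contra nj => /eqP ij1; apply/eqP/val_inj.
pose B i j := pair_form l.+1 (fx i) (fx j).
have -> : \matrix_(i, j) pair_form l.+1 (f i) (f j) = \matrix_(i, j) B i j :> 'M[K]_(n.*2).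
  by apply/matrixP => i j; rewrite !mxE /B !fxE.
rewrite (@pf_rowop _ _ B k); first last.
- rewrite /k; case: ifP => // /andP[_]; rewrite /fx insubN //.
  by rewrite -leqNgt; case: (n).
- by move=> i j; rewrite /B form_skew.
transitivity (pf (\matrix_(i, j) \sum_c \sum_d U i c * U j d * pair_form l c d)).
  congr pf; apply/matrixP => i j; rewrite !mxE /B /= mulrBr !mulr_sumr -!sumrB.
  apply: eq_bigr => c _; rewrite !mulr_sumr -!sumrB; apply: eq_bigr => d _.
  by rewrite !UE; ring.
rewrite (pf_gram U (fun c d : 'I_M => pair_form l c d)) [RHS]big_mkcond /=.
apply: eq_bigr => h _.
have [al|/forallPn[i nal]] := boolP [forall i, row_peeling l f i (h i)]; last first.
  rewrite (bigD1 i) //= {1}/U (negbTE nal) !mul0r.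
  by case: ifP => // /peelingP[al _]; move: nal; rewrite al.
have {}al := forallP al.
have -> : \prod_x U x (h x) = \prod_i \prod_(row_length (h i) <= k < row_length (f i)) y l k.
  by apply: eq_bigr => i _; rewrite /U al.
case: ifPn => // nv.
have [hinj|/injectivePn[i [j ij hij]]] := boolP (injectiveb h); last first.
  rewrite (@pf_repeat _ _ _ (fun c d : 'I_M => pair_form l c d) h i j) ?mulr0 //.
  by move=> c d; exact: form_skew.
case/negP: nv; apply/peelingP; split=> // i j ij.
rewrite ltn_neqAle (row_peeling_noninc lN fok al ij) andbT.
apply/eqP => /val_inj /(injectiveP _ hinj) ji.
by move: ij; rewrite ji ltnn.
Qed.

Lemma pf_form0 n (f : 'I_(n.*2) -> nat) : state_ok 0 f ->
  pf (\matrix_(i, j) pair_form 0 (f i) (f j) : 'M[K]_(n.*2)) =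
  [forall i, row_length (f i) == 0%N]%:R.
Proof.
move=> [fdec _].
have [/forallP dead|/forallPn[i0]] := boolP [forall i, row_length (f i) == 0%N].
  transitivity (pf (\matrix_(i, j) (i < j)%N%:R : 'M[K]_(n.*2))); last exact: pf_ones.
  apply: pf_eq_upper => i j ij; rewrite !mxE /=.
  have := dead i; have := dead j; rewrite /row_length !subn_eq0 => -> -> /=.
  by rewrite ij fdec // ltnNge ltnW ?subr0 // fdec.
rewrite /row_length subn_eq0 => /negbTE live.
by apply: (pf_row0 (i := i0)) => j; rewrite !mxE /= live ?andbF.
Qed.

End Transfer.

(** * Tableaux and the removal of their largest letter *)

Section Tableaux.
Variables (K : numDomainType) (y : nat -> nat -> K) (N L r : nat).

(** Fillings of all shapes with rows of length at most [L] live in one finite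
    type: [N], which is larger than any letter, marks the cells outside the
    shape.  Cells are indexed by row and content, so [(i, k)] lies in column
    [i + k]. *)
Definition box := {ffun 'I_r * 'I_L.+1 -> 'I_N.+1}.

Implicit Types (m : box) (la mu : 'I_r -> nat).

Definition entry m (i : 'I_r) (k : nat) : nat := m (i, inord k).

Record tableau l la m : Prop := Tableau {
  tab_in : forall i k, (k < la i)%N -> (entry m i k < l)%N;
  tab_out : forall i k, (la i <= k)%N -> (k <= L)%N -> entry m i k = N;
  tab_row : forall i k k', (k <= k')%N -> (k' < la i)%N -> (entry m i k <= entry m i k')%N;
  tab_col : forall (i i' : 'I_r) k k', (i <= i')%N -> (k < la i)%N -> (k' < la i')%N ->
    (i + k = i' + k')%N -> (entry m i k <= entry m i' k')%N;
  tab_primed : forall i k k', (k < la i)%N -> (k' < la i)%N ->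
    ~~ odd (entry m i k) -> entry m i k = entry m i k' -> k = k';
  tab_unprimed : forall (i i' : 'I_r) k k', (k < la i)%N -> (k' < la i')%N ->
    (i + k = i' + k')%N -> odd (entry m i k) -> entry m i k = entry m i' k' -> i = i' }.

Definition weight la m : K := \prod_i \prod_(0 <= k < la i) y (entry m i k) k.

Definition tab_sum l la : K := \sum_(m | `[< tableau l la m >]) weight la m.

(** Recolouring the skew shape [la / mu] with [N] erases the letter from it, and
    recolouring with [l] restores it. *)
Definition recolor la mu (l : nat) m : box :=
  [ffun u : 'I_r * 'I_L.+1 => if (mu u.1 <= u.2 < la u.1)%N then inord l else m u].

Lemma entry_recolor la mu l m i k : (k <= L)%N -> (l <= N)%N ->
  entry (recolor la mu l m) i k = if (mu i <= k < la i)%N then l else entry m i k.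
Proof.
by move=> kL lN; rewrite /entry ffunE /= inordK //; case: ifP => // _; rewrite inordK.
Qed.

Lemma box_eq m m' : (forall i k, (k <= L)%N -> entry m i k = entry m' i k) -> m = m'.
Proof.
move=> E; apply/ffunP => -[i k]; apply: val_inj.
by have := E i k (ltn_ord k); rewrite /entry inord_val.
Qed.

Definition small_cells l la mu m :=
  forall i k, (k < la i)%N -> (entry m i k < l)%N = (k < mu i)%N.

Lemma tableau_shrink l la mu m : (forall i, (mu i <= la i)%N) ->
  (forall i, (la i <= L)%N) ->
  tableau l.+1 la m -> small_cells l la mu m ->
  tableau l mu (recolor la mu N m).
Proof.
move=> mula laL tm sm.
have inE i k : (k < mu i)%N -> entry (recolor la mu N m) i k = entry m i k.
  move=> kmu; have := mula i; have := laL i => ? ?.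
  by rewrite entry_recolor //; [case: ifP; lia|lia].
have lt_la i k : (k < mu i)%N -> (k < la i)%N by have := mula i; lia.
split.
- by move=> i k kmu; rewrite inE // sm // lt_la.
- move=> i k muk kL; rewrite entry_recolor //; case: ifPn => // nb.
  by apply: (tab_out tm) => //; lia.
- move=> i k k' kk' k'mu; rewrite !inE //; last by lia.
  by apply: (tab_row tm) => //; exact: lt_la.
- move=> i i' k k' ii' kmu k'mu' E; rewrite !inE //.
  by apply: (tab_col tm) => //; exact: lt_la.
- move=> i k k' kmu k'mu; rewrite !inE //.
  by apply: (tab_primed tm); exact: lt_la.
- move=> i i' k k' kmu k'mu' E; rewrite !inE //.
  by apply: (tab_unprimed tm) => //; exact: lt_la.
Qed.

(** The hypotheses on the shapes say that [mu] is strict, and that [la / mu] has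
    at most one cell in each row if [l] is primed and in each column if it is
    unprimed.  Strictness keeps the new cells from lying above old ones. *)
Lemma tableau_grow l la mu m : (l < N)%N -> (forall i, (mu i <= la i)%N) ->
  (forall i, (la i <= L)%N) ->
  (forall i i' : 'I_r, (i <= i')%N -> (0 < mu i')%N -> (mu i' + (i' - i) <= mu i)%N) ->
  (~~ odd l -> forall i, (la i <= (mu i).+1)%N) ->
  (odd l -> forall i i' : 'I_r, (i < i')%N -> (0 < la i')%N -> (la i' + (i' - i) <= mu i)%N) ->
  tableau l mu m ->
  [/\ tableau l.+1 la (recolor la mu l m), small_cells l la mu (recolor la mu l m)
    & recolor la mu N (recolor la mu l m) = m].
Proof.
move=> lN mula laL gap vert horiz tm.
have E i k : (k < la i)%N ->
    entry (recolor la mu l m) i k = if (k < mu i)%N then entry m i k else l.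
  move=> kla; have := laL i => ?; rewrite entry_recolor; try lia.
  by rewrite kla andbT leqNgt; case: (k < mu i)%N.
have ltl i k : (k < mu i)%N -> (entry m i k < l)%N := tab_in tm (k := k).
split.
- split.
  + by move=> i k kla; rewrite E //; case: ifP => // /ltl /ltnW.
  + move=> i k lak kL; rewrite entry_recolor //; last by lia.
    rewrite ltnNge lak andbF; apply: (tab_out tm) => //.
    exact: leq_trans (mula i) lak.
  + move=> i k k' kk' k'la; rewrite !E //; last by lia.
    case: ifPn => [kmu|kmu]; case: ifPn => [k'mu|k'mu] //.
    * exact: (tab_row tm).
    * exact/ltnW/ltl.
    * by lia.
  + move=> i i' k k' ii' kla k'la' e; rewrite !E //.
    case: ifPn => [kmu|kmu]; case: ifPn => [k'mu|k'mu] //.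
    * exact: (tab_col tm).
    * exact/ltnW/ltl.
    * by have := gap i i' ii' ltac:(lia); lia.
  + move=> i k k' kla k'la; rewrite !E //.
    case: ifPn => [kmu|kmu]; case: ifPn => [k'mu|k'mu].
    * exact: (tab_primed tm).
    * by have := ltl _ _ kmu; lia.
    * by have := ltl _ _ k'mu; lia.
    * by move=> /vert /(_ i); lia.
  + move=> i i' k k' kla k'la' e; rewrite !E //.
    case: ifPn => [kmu|kmu]; case: ifPn => [k'mu|k'mu].
    * exact: (tab_unprimed tm).
    * by have := ltl _ _ kmu; lia.
    * by have := ltl _ _ k'mu; lia.
    * move=> /horiz hz _; case: (ltngtP i i') => [ii'|ii'|/val_inj //].
        by have := hz i i' ii' ltac:(lia); lia.
      by have := hz i' i ii' ltac:(lia); lia.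
- move=> i k kla; rewrite E //; case: ifP => [/ltl//|_]; exact: ltnn.
apply: box_eq => i k kL; rewrite !entry_recolor //; last by lia.
case: ifP => [/andP[muk _]|-> //].
by rewrite (tab_out tm).
Qed.

Lemma weight_grow l la mu m : (l < N)%N -> (forall i, (mu i <= la i)%N) ->
  (forall i, (la i <= L)%N) ->
  weight la (recolor la mu l m) =
  (\prod_i \prod_(mu i <= k < la i) y l k) * weight mu m.
Proof.
move=> lN mula laL; rewrite /weight -big_split; apply: eq_bigr => i _ /=.
rewrite (@big_cat_nat _ _ _ (mu i)) //= mulrC; congr (_ * _).
  rewrite big_nat [RHS]big_nat; apply: eq_bigr => k /andP[muk kla].
  have := laL i => ?; rewrite entry_recolor ?muk ?kla //; by lia.
rewrite big_nat [RHS]big_nat; apply: eq_bigr => k /andP[_ kmu].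
have := laL i; have := mula i => ? ?; rewrite entry_recolor; try lia.
by rewrite leqNgt kmu.
Qed.

End Tableaux.

Lemma decreasing_gap r (f : 'I_r -> nat) :
  (forall i j : 'I_r, (i < j)%N -> (f j < f i)%N) ->
  forall i j : 'I_r, (i <= j)%N -> (f j + (j - i) <= f i)%N.
Proof.
move=> dec i j; move dE : (j - i)%N => d.
elim: d j dE => [|d IH] j dE ij.
  have /val_inj -> : (i : nat) = j by lia.
  by rewrite addn0.
have j1 : (j.-1 < r)%N by have := ltn_ord j; lia.
have := IH (Ordinal j1) ltac:(rewrite /=; lia) ltac:(rewrite /=; lia).
by have := dec (Ordinal j1) j ltac:(rewrite /=; lia); lia.
Qed.

Section LastLetter.
Variables (K : numDomainType) (y : nat -> nat -> K) (N M L r : nat).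
Notation row_length := (row_length N).

Section Shape.
Variables (l : nat) (f : 'I_r -> nat).
Hypotheses (lN : (l < N)%N) (fok : state_ok N l.+1 f).
Hypotheses (fL : forall i, (row_length (f i) <= L)%N) (fM : forall i, (f i < M)%N).
Let la i := row_length (f i).

Definition peeled_length (m : box N L r) i :=
  find (fun k => (l <= entry m i k)%N) (iota 0 (la i)).

Lemma peeled_length_le m i : (peeled_length m i <= la i)%N.
Proof. by rewrite -[leqRHS](size_iota 0) find_size. Qed.

(** The row is weakly increasing, so its letters below [l] form an initial
    segment. *)
Lemma peeled_lengthP m : tableau l.+1 la m -> small_cells l la (peeled_length m) m.
Proof.
move=> tm i k kla; apply/idP/idP => [lt_l|]; last first.
  by move/(before_find 0%N); rewrite nth_iota // add0n ltnNge => ->.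
rewrite ltnNge; apply/negP => ck.
have cla : (peeled_length m i < la i)%N by lia.
have : has (fun k => (l <= entry m i k)%N) (iota 0 (la i)) by rewrite has_find size_iota.
move=> /(nth_find 0%N); rewrite -/(peeled_length m i) nth_iota // add0n.
by have := tab_row tm ck kla; lia.
Qed.

Lemma peeled_length_uniq m mu : tableau l.+1 la m -> (forall i, (mu i <= la i)%N) ->
  small_cells l la mu m -> peeled_length m =1 mu.
Proof.
move=> tm mula sm i; have := peeled_lengthP tm (i := i) => cm.
case: (ltngtP (peeled_length m i) (mu i)) => // lt.
  have := mula i => ?; have := cm (peeled_length m i) ltac:(lia).
  by rewrite ltnn sm //; lia.
have := peeled_length_le m i => ?; have := cm (mu i) ltac:(lia).
by rewrite lt sm ?ltnn //; lia.
Qed.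

Definition peeled_state m i :=
  if (f i <= N)%N then f i
  else if peeled_length m i == 0%N then (N - l)%N else (N + peeled_length m i)%N.

Lemma row_length_peeled m i : row_length (peeled_state m i) = peeled_length m i.
Proof.
have := peeled_length_le m i; rewrite /peeled_state /la /row_length.
by case: ifPn => ?; [lia|case: eqP; lia].
Qed.

Lemma peeled_state_le m i : (peeled_state m i <= f i)%N.
Proof.
have := peeled_length_le m i; rewrite /peeled_state /la /row_length.
by case: ifPn => ?; [lia|case: eqP; lia].
Qed.

(** Rows [i < j] are compared through a cell of row [j] and the cell of row [i] in
    the same column, whose content is larger by [j - i]. *)
Lemma peeled_state_peeling m : tableau l.+1 la m -> peeling N l f (peeled_state m).
Proof.
move=> tm; have [fdec fdead] := fok.
have cm := peeled_lengthP tm; have cle := peeled_length_le m.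
have gap (i j : 'I_r) : (i <= j)%N -> (0 < la j)%N -> (la j + (j - i) <= la i)%N.
  by move=> ij; have := decreasing_gap fdec ij; rewrite /la /row_length; lia.
have vert i : ~~ odd l -> (la i <= (peeled_length m i).+1)%N.
  move=> el; rewrite leqNgt; apply/negP => lt.
  have eql k : (peeled_length m i <= k)%N -> (k < la i)%N -> entry m i k = l.
    by move=> ck kla; have := tab_in tm kla; have := cm i k kla; lia.
  have := tab_primed tm (i := i) (k := peeled_length m i) (k' := (peeled_length m i).+1).
  by rewrite !eql; try lia; move=> /(_ ltac:(lia) ltac:(lia) el erefl); lia.
have horiz (i j : 'I_r) : odd l -> (i < j)%N -> (0 < la j)%N -> (la j < peeled_length m i)%N.
  move=> ol ij j0; have g := gap i j (ltnW ij) j0.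
  have k1 : (la j - 1 + (j - i) < la i)%N by lia.
  have k2 : (la j - 1 < la j)%N by lia.
  have e : (i + (la j - 1 + (j - i)) = j + (la j - 1))%N by lia.
  have le1 := tab_col tm (ltnW ij) k1 k2 e.
  have le2 := tab_in tm k2.
  have := cm i _ k1; have [eq_l|] := eqVneq (entry m i (la j - 1 + (j - i))) l; last by lia.
  have := tab_unprimed tm k1 k2 e; rewrite eq_l => /(_ ol ltac:(lia)) ji.
  by move: ij; rewrite ji ltnn.
apply/peelingP; split=> [i|i j ij].
  rewrite /row_peeling /step_ok row_length_peeled; apply/andP; split.
    have := peeled_state_le m i; rewrite /reachable /peeled_state -/(la i); have := vert i.
    by case: ifPn => //; case: eqP; case: (odd l) => /=; lia.
  apply/implyP => ol; apply/forallP => j; apply/implyP => /andP[ij fj].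
  have := horiz i j ol ij; have := fdec _ _ ij; rewrite /peeled_state /la /row_length.
  by case: ifPn => ?; [lia|case: eqP; lia].
have := fdec _ _ ij; have := fdead j; rewrite /peeled_state.
have [fjN|fjN] := leqP (f j) N; have [fiN|fiN] := leqP (f i) N; try lia.
  by case: eqP; lia.
move=> _ fij.
have [ol|el] := boolP (odd l).
  have := horiz i j ol ij; have := cle j; have := cle i; rewrite /la /row_length.
  by do 2!case: eqP; lia.
have vi := vert i el; have li : (la j < la i)%N by rewrite /la /row_length; lia.
have j0 : (0 < la j)%N by rewrite /la /row_length; lia.
suff : (0 < peeled_length m j)%N -> (peeled_length m j < peeled_length m i)%N.
  by do 2!case: eqP; lia.
move=> cj0; have cj := cle j.
have k1 : (peeled_length m j - 1 + (j - i) < la i)%N by have := gap i j (ltnW ij) j0; lia.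
have k2 : (peeled_length m j - 1 < la j)%N by lia.
have le1 := tab_col tm (ltnW ij) k1 k2 ltac:(lia).
by have := cm i _ k1; have := cm j _ k2; lia.
Qed.

Lemma peeled_state_uniq m (h : 'I_r -> nat) : tableau l.+1 la m -> peeling N l f h ->
  small_cells l la (fun i => row_length (h i)) m -> peeled_state m =1 h.
Proof.
move=> tm /peelingP[al _] sm i.
have mula j : (row_length (h j) <= la j)%N.
  have /andP[+ _] := al j; rewrite /step_ok; case: ifP => [_ /eqP -> //|_ /and3P[_ le _]].
  by rewrite /la /row_length; lia.
rewrite /peeled_state (peeled_length_uniq tm mula sm) /row_length.
have /andP[+ _] := al i; rewrite /step_ok; case: ifP => [_ /eqP -> //|_ /and3P[+ _ _]].
by rewrite /reachable => /orP[?|/eqP ->]; case: eqP; lia.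
Qed.

(** A tableau amounts to the states left after erasing the letter [l] together
    with the remaining tableau, the erased cells being determined by the two
    shapes. *)
Lemma tab_sum_step :
  tab_sum y N L l.+1 la =
  \sum_(h : {ffun 'I_r -> 'I_M} | peeling N l f (fun i => h i))
    (\prod_i \prod_(row_length (h i) <= k < la i) y l k) *
    tab_sum y N L l (fun i => row_length (h i)).
Proof.
pose H m : {ffun 'I_r -> 'I_M} :=
  [ffun i => Ordinal (leq_ltn_trans (peeled_state_le m i) (fM i))].
have HE m i : H m i = peeled_state m i :> nat by rewrite ffunE.
rewrite /tab_sum (partition_big H (fun h => peeling N l f (fun i => h i))) /=; last first.
  move=> m /asboolP /peeled_state_peeling; congr (is_true _).
  apply/peelingP/peelingP => -[al dec].
    by split=> [i|i j]; rewrite !HE //; exact: dec.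
  by split=> [i|i j]; [have := al i|have := dec i j]; rewrite !HE.
apply: eq_bigr => h vh; pose mu i := row_length (h i).
have mula i : (mu i <= la i)%N.
  have /peelingP[al _] := vh.
  have /andP[+ _] := al i; rewrite /step_ok /mu.
  by case: ifP => [_ /eqP -> //|_ /and3P[_ le _]]; rewrite /la /row_length; lia.
have predE m : `[< tableau l.+1 la m >] && (H m == h)
    = `[< tableau l.+1 la m /\ small_cells l la mu m >].
  apply/andP/asboolP => [[/asboolP tm /eqP hE]|[tm sm]].
    split=> // i k kla; rewrite (peeled_lengthP tm) //; congr (_ < _)%N.
    by rewrite -row_length_peeled -HE hE.
  split; first exact/asboolP.
  apply/eqP/ffunP => i; apply: val_inj; rewrite /= HE.
  exact: (peeled_state_uniq (h := fun i => h i)).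
rewrite (eq_bigl _ _ predE).
have [fdec fdead] := fok; have [hdec hdead] := peeling_ok lN fok vh.
have gap (i j : 'I_r) : (i <= j)%N -> (0 < mu j)%N -> (mu j + (j - i) <= mu i)%N.
  by move=> ij; have := decreasing_gap hdec ij; rewrite /mu /row_length; lia.
have /peelingP[al _] := vh.
have vert : ~~ odd l -> forall i, (la i <= (mu i).+1)%N.
  move=> el i; have /andP[+ _] := al i; rewrite /step_ok (negbTE el) /=.
  by case: ifP => [?|_ /and3P[_ _ //]]; rewrite /la /row_length; lia.
have horiz : odd l -> forall i j : 'I_r, (i < j)%N -> (0 < la j)%N ->
    (la j + (j - i) <= mu i)%N.
  move=> ol i j ij j0.
  have i1 : (i.+1 < r)%N by exact: leq_ltn_trans ij (ltn_ord j).
  have gj := decreasing_gap fdec (i := Ordinal i1) (j := j) ij.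
  have /andP[_ /implyP/(_ ol)/forallP/(_ (Ordinal i1))] := al i.
  by move: gj j0; rewrite /= ltnSn /= /la /mu /row_length; case: ltnP; lia.
rewrite (reindex_onto (recolor la mu l) (recolor la mu N)) /=; last first.
  move=> m /asboolP[tm sm]; apply: box_eq => i k kL; rewrite !entry_recolor //; try lia.
  case: ifP => [/andP[muk kla]|-> //].
  by have := tab_in tm kla; have := sm i k kla; lia.
rewrite mulr_sumr; apply: eq_big => [m|m /andP[_ _]]; last exact: weight_grow.
apply/andP/asboolP => [[/asboolP[tm sm] /eqP <-]|tm].
  exact: tableau_shrink.
have [t1 t2 t3] := tableau_grow lN mula fL gap vert horiz tm.
by split; [apply/asboolP|apply/eqP].
Qed.

End Shape.

Lemma tab_sum0 (la : 'I_r -> nat) : (forall i, (la i <= L)%N) ->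
  tab_sum y N L 0 la = [forall i, la i == 0%N]%:R.
Proof.
move=> laL; rewrite /tab_sum; case: (boolP [forall i, la i == 0%N]) => [/forallP la0|].
  rewrite (big_pred1 [ffun=> ord_max]) /=.
    by rewrite /weight big1 // => i _; rewrite (eqP (la0 i)) big_geq.
  move=> m; apply/asboolP/eqP => [tm|->].
    apply: box_eq => i k kL; rewrite (tab_out tm) ?(eqP (la0 i)) //.
    by rewrite /entry ffunE.
  have nla i k : (k < la i)%N = false by rewrite (eqP (la0 i)).
  split=> [i k|i k _ _|i k k' _|i i' k k' _|i k k'|i i' k k']; rewrite ?nla //.
  by rewrite /entry ffunE.
rewrite negb_forall => /existsP[i0 li0]; rewrite big_pred0 // => m.
apply/asboolP => tm; have := tab_in tm (i := i0) (k := 0%N).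
by rewrite lt0n => /(_ li0).
Qed.

End LastLetter.

(** Both sides satisfy the same recursion in [l]. *)
Theorem tab_sum_pf (K : numDomainType) (y : nat -> nat -> K) N M L n l
    (f : 'I_(n.*2) -> nat) : (l <= N)%N -> state_ok N l f ->
  (forall i, (row_length N (f i) <= L)%N) -> (forall i, (f i < M)%N) ->
  tab_sum y N L l (fun i => row_length N (f i)) =
  pf (\matrix_(i, j) pair_form y N M l (f i) (f j) : 'M[K]_(n.*2)).
Proof.
elim: l f => [|l IH] f lN fok fL fM; first by rewrite tab_sum0 // pf_form0.
rewrite (tab_sum_step y lN fok fL fM) pf_form_step //; apply: eq_bigr => h vh.
congr (_ * _); apply: (IH (fun i => h i)) => //; first exact: ltnW.
  exact: peeling_ok vh.
move=> i; apply: leq_trans (fL i); have /peelingP[al _] := vh.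
have /andP[+ _] := al i; rewrite /step_ok; case: ifP => [_ /eqP -> //|_ /and3P[_ le _]].
by rewrite /row_length leq_sub2r.
Qed.

(** * Limits of unordered complex sums *)

Import numFieldNormedType.Exports.
Local Open Scope classical_set_scope.

Section ComplexLimits.
Variable R : realType.
Implicit Types (u v : nat -> R[i]) (a b : R[i]).

(** Convergence of real and imaginary parts, in line with [csum], which sums them
    separately. *)
Definition ccvg u a : Prop :=
  (fun k => complex.Re (u k)) @ \oo --> complex.Re a /\
  (fun k => complex.Im (u k)) @ \oo --> complex.Im a.

Lemma ccvg_cst a : ccvg (fun=> a) a.
Proof. by split; exact: cvg_cst. Qed.

Lemma ccvg_unique u a b : ccvg u a -> ccvg u b -> a = b.
Proof.
move=> [ra ia] [rb ib].
case: a b ra ia rb ib => [xa ya] [xb yb] /= ra ia rb ib.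
by congr (_ +i* _)%C; [exact: (cvg_unique _ ra rb)|exact: (cvg_unique _ ia ib)].
Qed.

Lemma ccvgD u v a b : ccvg u a -> ccvg v b -> ccvg (fun k => u k + v k) (a + b).
Proof.
move=> [ra ia] [rb ib]; split.
  have -> : complex.Re (a + b) = complex.Re a + complex.Re b.
    by case: a b {ra ia rb ib} => [? ?] [? ?].
  have -> : (fun k => complex.Re (u k + v k)) = (fun k => complex.Re (u k) + complex.Re (v k)).
    by apply/funext => k; case: (u k) (v k) => [? ?] [? ?].
  exact: cvgD.
have -> : complex.Im (a + b) = complex.Im a + complex.Im b.
  by case: a b {ra ia rb ib} => [? ?] [? ?].
have -> : (fun k => complex.Im (u k + v k)) = (fun k => complex.Im (u k) + complex.Im (v k)).
  by apply/funext => k; case: (u k) (v k) => [? ?] [? ?].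
exact: cvgD.
Qed.

Lemma ccvgM u v a b : ccvg u a -> ccvg v b -> ccvg (fun k => u k * v k) (a * b).
Proof.
move=> [ra ia] [rb ib]; split.
  have -> : complex.Re (a * b) = complex.Re a * complex.Re b - complex.Im a * complex.Im b
    by case: a b {ra ia rb ib} => [? ?] [? ?].
  have -> : (fun k => complex.Re (u k * v k)) = (fun k => complex.Re (u k) * complex.Re (v k)
      - complex.Im (u k) * complex.Im (v k)).
    by apply/funext => k; case: (u k) (v k) => [? ?] [? ?].
  by apply: cvgB; exact: cvgM.
have -> : complex.Im (a * b) = complex.Re a * complex.Im b + complex.Im a * complex.Re b
  by case: a b {ra ia rb ib} => [? ?] [? ?].
have -> : (fun k => complex.Im (u k * v k)) = (fun k => complex.Re (u k) * complex.Im (v k)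
    + complex.Im (u k) * complex.Re (v k)).
  by apply/funext => k; case: (u k) (v k) => [? ?] [? ?].
by apply: cvgD; exact: cvgM.
Qed.

Lemma ccvg_sum (I : Type) (r : seq I) (P : pred I) (u : I -> nat -> R[i]) (a : I -> R[i]) :
  (forall x, P x -> ccvg (u x) (a x)) ->
  ccvg (fun k => \sum_(x <- r | P x) u x k) (\sum_(x <- r | P x) a x).
Proof.
move=> ua; elim: r => [|x r IH].
  by under eq_fun do rewrite big_nil; rewrite big_nil; exact: ccvg_cst.
under eq_fun do rewrite big_cons; rewrite big_cons.
by case: ifP => // Px; apply: ccvgD => //; exact: ua.
Qed.

Lemma ccvg_prod (I : Type) (r : seq I) (P : pred I) (u : I -> nat -> R[i]) (a : I -> R[i]) :
  (forall x, P x -> ccvg (u x) (a x)) ->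
  ccvg (fun k => \prod_(x <- r | P x) u x k) (\prod_(x <- r | P x) a x).
Proof.
move=> ua; elim: r => [|x r IH].
  by under eq_fun do rewrite big_nil; rewrite big_nil; exact: ccvg_cst.
under eq_fun do rewrite big_cons; rewrite big_cons.
by case: ifP => // Px; apply: ccvgM => //; exact: ua.
Qed.

Lemma ccvg_pf n (A : nat -> 'M[R[i]]_(n.*2)) (B : 'M[R[i]]_(n.*2)) :
  (forall i j : 'I_(n.*2), (i < j)%N -> ccvg (fun k => A k i j) (B i j)) ->
  ccvg (fun k => pf (A k)) (pf B).
Proof.
move=> AB; apply: ccvg_sum => p /matchingsP[_ p2].
apply: ccvgM; first exact: ccvg_cst.
by apply: ccvg_prod => i _; exact: AB.
Qed.

End ComplexLimits.

Section UnorderedSums.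
Variable (R : realType) (T : choiceType).
Implicit Types (D : set T) (g : T -> R).

Lemma esum_subset D D' (a : T -> \bar R) : D `<=` D' ->
  (\esum_(x in D) a x <= \esum_(x in D') a x)%E.
Proof.
move=> DD'; apply: ereal_sup_le => _ [F [fF FD] <-]; exists F => //.
by split=> //; exact: subset_trans FD DD'.
Qed.

(** A finite subset of the union of an increasing sequence lies in one of its
    members, so the two suprema of finite sums agree. *)
Lemma esum_cvg (Dn : nat -> set T) D (a : T -> \bar R) : (forall x, (0 <= a x)%E) ->
  (forall m n, (m <= n)%N -> Dn m `<=` Dn n) -> \bigcup_n Dn n = D ->
  (fun n => \esum_(x in Dn n) a x)%E @ \oo --> (\esum_(x in D) a x)%E.
Proof.
move=> a0 Dinc DE.
have -> : (\esum_(x in D) a x = ereal_sup (range (fun n => \esum_(x in Dn n) a x)))%E.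
  apply/eqP; rewrite eq_le; apply/andP; split; last first.
    apply: ge_ereal_sup => _ [n _ <-]; apply: esum_subset.
    by rewrite -DE; exact: bigcup_sup.
  apply: ge_ereal_sup => _ [F [fF FD] <-].
  pose lev x := if pselect (exists n, Dn n x) is left e then sval (cid e) else 0%N.
  have /finite_seqP[s sE] := fF.
  pose n := (\max_(x <- s) lev x)%N.
  apply: le_trans (ereal_sup_ubound (ex_intro2 _ _ n I erefl)).
  apply: ereal_sup_ubound; exists F => //; split=> // x Fx.
  have levx : Dn (lev x) x.
    rewrite /lev; case: pselect => [e|]; first by case: cid.
    by case; have := FD _ Fx; rewrite -DE => -[k _ kx]; exists k.
  apply: Dinc levx; apply: (leq_bigmax_seq (F := lev)) => //.
  by move: Fx; rewrite sE.
by apply: ereal_nondecreasing_cvgn => m n mn; apply: esum_subset; exact: Dinc.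
Qed.

Lemma esum_real_cvg (Dn : nat -> set T) D g :
  (\esum_(x in D) `|g x|%:E < +oo)%E ->
  (forall m n, (m <= n)%N -> Dn m `<=` Dn n) -> \bigcup_n Dn n = D ->
  (fun n => esum_real (Dn n) g) @ \oo --> esum_real D g.
Proof.
move=> gfin Dinc DE.
have half (h : T -> R) : (forall x, h x <= `|g x|) ->
    (fun n => fine (\esum_(x in Dn n) (Num.max (h x) 0)%:E)%E) @ \oo -->
    fine (\esum_(x in D) (Num.max (h x) 0)%:E)%E.
  move=> hg; apply: fine_cvg; rewrite fineK.
    by apply: esum_cvg => // x; rewrite lee_fin le_max lexx orbT.
  rewrite ge0_fin_numE; last by apply: esum_ge0 => x _; rewrite lee_fin le_max lexx orbT.
  apply: le_lt_trans gfin; apply: le_esum => x _.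
  by rewrite lee_fin ge_max hg normr_ge0.
by apply: cvgB; apply: half => x; rewrite ?ler_norm // -normrN ler_norm.
Qed.

Lemma normc_Re_ge (z : R[i]) :
  `|complex.Re z| <= complex.Re `|z| /\ `|complex.Im z| <= complex.Re `|z|.
Proof.
case: z => x y; rewrite normc_def /=; split.
  by rewrite -sqrtr_sqr ler_wsqrtr // lerDl sqr_ge0.
by rewrite -sqrtr_sqr ler_wsqrtr // lerDr sqr_ge0.
Qed.

Lemma csum_cvg (Dn : nat -> set T) D (f : T -> R[i]) : abs_summable D f ->
  (forall m n, (m <= n)%N -> Dn m `<=` Dn n) -> \bigcup_n Dn n = D ->
  ccvg (fun n => csum (Dn n) f) (csum D f).
Proof.
move=> fsum Dinc DE.
have dom (g : T -> R) : (forall x, `|g x| <= complex.Re `|f x|) ->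
    (\esum_(x in D) `|g x|%:E < +oo)%E.
  move=> gf; apply: le_lt_trans fsum; apply: le_esum => x _.
  by rewrite abse_EFin lee_fin; apply: le_trans (gf x) (ler_norm _).
by split; apply: esum_real_cvg => //; apply: dom => x; case: (normc_Re_ge (f x)).
Qed.

Lemma esum_image (I : finType) (P : pred I) (e : I -> T) (a : T -> \bar R) :
  (forall x, (0 <= a x)%E) -> {in P &, injective e} ->
  (\esum_(x in e @` [set` P]) a x = \sum_(i | P i) a (e i))%E.
Proof.
move=> a0 einj; rewrite (reindex_esum [set` P] _ e); last first.
  apply: inj_bij => i j; rewrite !inE => Pi Pj; exact: einj.
rewrite esum_fset //.
by rewrite -(bigfs _ (index_enum_uniq I)) // => i _; rewrite mem_index_enum.
Qed.

Lemma csum_image (I : finType) (P : pred I) (e : I -> T) (f : T -> R[i]) :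
  {in P &, injective e} -> csum (e @` [set` P]) f = \sum_(i | P i) f (e i).
Proof.
move=> einj.
have realE g : esum_real (e @` [set` P]) g = \sum_(i | P i) g (e i).
  rewrite /esum_real !esum_image //; try by move=> x; rewrite lee_fin le_max lexx orbT.
  rewrite !sumEFin /= -sumrB; apply: eq_bigr => i _.
  by rewrite /Num.max oppr_lt0; case: ltgtP => ?; rewrite ?subr0 ?sub0r ?opprK //; lra.
rewrite /csum !realE; elim/big_rec3: _ => // i x a b _ <-.
by case: (f _).
Qed.

End UnorderedSums.

(** * Truncated Schur Q-multiple zeta functions *)

Definition letter (l : nat) : Nprime := (l./2, odd l).

Lemma letter_le a b : (letter a <= letter b)%O = (a <= b)%N.
Proof.
rewrite /letter lexi_pair !leEnat leEbool.
have := odd_double_half a; have := odd_double_half b.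
by case: (odd a); case: (odd b) => /=; lia.
Qed.

Lemma letter_inj : injective letter.
Proof.
move=> a b [ab oab]; rewrite -(odd_double_half a) -(odd_double_half b).
by rewrite ab oab.
Qed.

(** [true], that is no prime, counts as 1. *)
Definition letter_index (x : Nprime) : nat := (x.2 + x.1.*2)%N.

Lemma letter_indexK x : letter (letter_index x) = x.
Proof.
case: x => a b; rewrite /letter /letter_index /= half_bit_double.
by rewrite oddD odd_double addbF oddb.
Qed.

Section Truncation.
Variables (R : realType) (r : nat) (lam : 'I_r -> nat).
Variables (N L : nat).
Hypothesis lamL : forall i, (lam i <= L)%N.

Definition QSST_below : set (ST lam Nprime) :=
  [set m | QSST m /\ forall c, ((m c).1 < N)%N].

Definition fill (m : box N.*2 L r) : ST lam Nprime :=
  [ffun c : cell lam => letter (entry m (tag c) (tagged c))].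

Definition mk_cell i k (kl : (k < lam i)%N) : cell lam :=
  Tagged (fun i => 'I_(lam i)) (Ordinal kl).

Lemma fill_cell m i k (kl : (k < lam i)%N) : fill m (mk_cell kl) = letter (entry m i k).
Proof. by rewrite ffunE. Qed.

Lemma cell_eq (c d : cell lam) : tag c = tag d -> tagged c = tagged d :> nat -> c = d.
Proof.
case: c d => [i k] [j k'] /= ij; case: j / ij k' => k' /= kk.
by congr existT; exact: val_inj.
Qed.

Lemma cell_mk (c : cell lam) : c = mk_cell (ltn_ord (tagged c)).
Proof. exact: cell_eq. Qed.

Lemma fill_QSST m : tableau N.*2 lam m -> QSST_below (fill m).
Proof.
move=> tm; split; last first.
  move=> c; rewrite ffunE /=; have := tab_in tm (ltn_ord (tagged c)).
  by set e := entry _ _ _; have := odd_double_half e; lia.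
split=> c d; rewrite /row_of /col_of.
- move=> [/val_inj cd] le; rewrite !ffunE letter_le; move: le.
  case: c d cd => [i k] [j k'] /= ij; case: j / ij k' => k' /= le.
  by apply: (tab_row tm); [lia|exact: ltn_ord].
- move=> e le; rewrite !ffunE letter_le.
  by apply: (tab_col tm); [lia|exact: ltn_ord|exact: ltn_ord|lia].
- move=> [/val_inj cd]; rewrite !ffunE /primed /= => nodd /letter_inj e.
  apply: cell_eq => //; apply: (tab_primed tm (i := tag c)) => //.
  + by rewrite cd; exact: ltn_ord.
  + by rewrite e cd.
- rewrite !addSn => -[e]; rewrite !ffunE /primed /= negbK => od /letter_inj e2.
  have cd : tag c = tag d.
    by apply: (tab_unprimed tm (ltn_ord _) (ltn_ord _) _ od e2).
  by apply: cell_eq => //; move: e; rewrite (congr1 val cd) => /addnI.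
Qed.

Lemma QSST_fill t : QSST_below t -> exists2 m, tableau N.*2 lam m & fill m = t.
Proof.
move=> [[row col prim unprim] tN].
pose val_at (i : 'I_r) k : nat := if insub k is Some k' then
   letter_index (t (Tagged (fun i => 'I_(lam i)) (k' : 'I_(lam i)))) else N.*2.
have valE i k (kl : (k < lam i)%N) : val_at i k = letter_index (t (mk_cell kl)).
  by rewrite /val_at insubT.
have val_lt i k : (k < lam i)%N -> (val_at i k < N.*2)%N.
  move=> kl; rewrite valE /letter_index; have := tN (mk_cell kl).
  by case: (t _).2 => /=; lia.
have val_le i k : (val_at i k <= N.*2)%N.
  by have [/val_lt/ltnW//|ge] := ltnP k (lam i); rewrite /val_at insubN // -leqNgt.
pose m : box N.*2 L r := [ffun u : 'I_r * 'I_L.+1 => inord (val_at u.1 u.2)].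
have entE i k : (k <= L)%N -> entry m i k = val_at i k.
  by move=> kL; rewrite /entry ffunE /= !inordK ?ltnS.
have entl i k (kl : (k < lam i)%N) : letter (entry m i k) = t (mk_cell kl).
  by rewrite entE ?valE ?letter_indexK //; have := lamL i; lia.
exists m; last first.
  by apply/ffunP => c; rewrite [c in RHS]cell_mk -entl ffunE.
split.
- by move=> i k kl; rewrite entE ?val_lt //; have := lamL i; lia.
- by move=> i k lk kL; rewrite entE // /val_at insubN // -leqNgt.
- move=> i k k' kk' k'l; have kl := leq_ltn_trans kk' k'l.
  by rewrite -letter_le !entl; apply: row => //; rewrite /col_of /=; lia.
- move=> i i' k k' ii' kl k'l e; rewrite -letter_le !entl.
  by apply: col; rewrite /row_of /col_of /=; lia.
- move=> i k k' kl k'l od e.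
  have := prim (mk_cell kl) (mk_cell k'l) erefl.
  rewrite -!entl e => /(_ _ erefl) H.
  have : mk_cell kl = mk_cell k'l by apply: H; rewrite /primed /= -e.
  by move=> /(congr1 (fun c : cell lam => tagged c : nat)).
- move=> i i' k k' kl k'l e od e2.
  have := unprim (mk_cell kl) (mk_cell k'l).
  rewrite -!entl e2 => /(_ _ _ erefl) H.
  have : mk_cell kl = mk_cell k'l.
    by apply: H; rewrite /col_of /primed /= -?e2 ?negbK //; lia.
  by move=> /(congr1 tag).
Qed.

Lemma fill_inj : {in [pred m | `[< tableau N.*2 lam m >]] &, injective fill}.
Proof.
move=> m m' tm0 tm0' mm'.
have tm : tableau N.*2 lam m by exact/asboolP.
have tm' : tableau N.*2 lam m' by exact/asboolP.
apply: box_eq => i k kL; have [kl|lk] := ltnP k (lam i).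
  by apply: letter_inj; rewrite -!(fill_cell _ kl) mm'.
by rewrite (tab_out tm) ?(tab_out tm').
Qed.

Lemma QSST_below_image :
  QSST_below = fill @` [set` [pred m | `[< tableau N.*2 lam m >]]].
Proof.
apply/seteqP; split=> [t /QSST_fill[m tm <-]|_ [m + <-]].
  by exists m => //; exact/asboolP.
by move=> tm; apply: fill_QSST; exact/asboolP.
Qed.

Lemma csum_below (s : ST lam R[i]) (sg : nat -> R[i]) :
  (forall c, s c = sg (tagged c)) ->
  csum QSST_below (zetaQ_term s) =
  tab_sum (fun l k => npow l./2.+1 (- sg k)) N.*2 L N.*2 lam.
Proof.
move=> sE; rewrite QSST_below_image csum_image; last exact: fill_inj.
apply: eq_bigr => m _.
rewrite /zetaQ_term /weight.
under [RHS]eq_bigr do rewrite big_mkord.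
rewrite sig_big_dep /=; apply: eq_bigr => c _.
by rewrite ffunE sE.
Qed.

End Truncation.

Lemma QSST_below_mono r (lam : 'I_r -> nat) M N : (M <= N)%N ->
  @QSST_below r lam M `<=` @QSST_below r lam N.
Proof. by move=> MN t [qt tM]; split=> // c; exact: leq_trans (tM c) MN. Qed.

Lemma QSST_below_cover r (lam : 'I_r -> nat) :
  \bigcup_N @QSST_below r lam N = @QSST r lam.
Proof.
apply/seteqP; split=> [t [N _ [] //]|t qt].
exists (\max_c (t c).1).+1 => //; split=> // c; rewrite ltnS.
exact: (leq_bigmax (F := fun c => (t c).1)).
Qed.

Lemma pf1 (K : comNzRingType) (A : 'M[K]_(1.*2)) : pf A = A ord0 ord_max.
Proof.
rewrite /pf (big_pred1 1%g) => [|p] /=.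
  rewrite odd_perm1 mul1r big_ord1 !perm1; congr (A _ _); exact: val_inj.
apply/matchingsP/eqP => [[_ p2]|->]; last first.
  by split=> [i j|i]; rewrite ?ord1 //= !perm1.
have := p2 ord0; case E : (p _) => [[|[|a]] ha] //; case E' : (p _) => [[|[|b]] hb] // _.
have pE : forall x : 'I_(1.*2), p x = x.
  move=> [[|[|x]] hx] //; apply: val_inj.
    by rewrite (_ : Ordinal hx = ord_fst ord0) ?E //; apply: val_inj.
  by rewrite (_ : Ordinal hx = ord_snd ord0) ?E' //; apply: val_inj.
by apply/permP => x; rewrite pE perm1.
Qed.

(** The first row of a strict partition is the longest, so it meets every
    diagonal. *)
Lemma STdiag_content r (lam : 'I_r -> nat) (X : Type) (x0 : X) (s : ST lam X) :
  strict_partition lam -> STdiag s ->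
  exists sg : nat -> X, forall c, s c = sg (tagged c).
Proof.
move=> lamS sdiag.
exists (fun k => if pselect (exists c : cell lam, tagged c = k :> nat) is left e
                 then s (sval (cid e)) else x0) => c.
case: pselect => [e|]; last by case; exists c.
case: (cid e) => d /= dc.
have r0 : (0 < r)%N by exact: leq_ltn_trans (ltn_ord (tag c)).
have k0 : (tagged c < lam (Ordinal r0))%N.
  apply: leq_trans (ltn_ord _) _.
  have [tc0|tc0] := posnP (tag c); last exact/ltnW/lamS.
  by rewrite (_ : Ordinal r0 = tag c) //; exact/val_inj.
have sc := sdiag c (mk_cell k0); have sd := sdiag d (mk_cell k0).
by rewrite sc ?sd // /col_of /row_of /=; lia.
Qed.

(** * The Pfaffian formula *)

(** A strict partition has at most one empty row, so the single state [0] is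
    enough for rows that are empty from the start. *)
Definition start_state N h := if h == 0%N then 0%N else (N + h)%N.

Lemma row_length_start N h : row_length N (start_state N h) = h.
Proof. by rewrite /row_length /start_state; case: eqP => [->|_]; rewrite ?sub0n // addKn. Qed.

(** The truncation to [N] numbers uses [2N] letters; the matrix depends on each
    row through its length only, so a two-row shape gives a single entry of it. *)
Lemma csum_below_pf (R : realType) n (lam : 'I_(n.*2) -> nat) (s : ST lam R[i])
    (sg : nat -> R[i]) N L :
  strict_partition lam -> (forall i, (lam i <= L)%N) ->
  (forall c, s c = sg (tagged c)) ->
  csum (@QSST_below _ lam N) (zetaQ_term s) =
  pf (\matrix_(i, j) pair_form (fun l k => npow l./2.+1 (- sg k)) N.*2
        (N.*2 + L).+1 N.*2 (start_state N.*2 (lam i)) (start_state N.*2 (lam j))).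
Proof.
move=> lamS lamL sE; rewrite (csum_below N lamL sE).
have lamE : (fun i => row_length N.*2 (start_state N.*2 (lam i))) = lam.
  by apply/funext => i; rewrite row_length_start.
rewrite -[X in tab_sum _ _ _ _ X]lamE; apply: tab_sum_pf => //.
- split=> [i j /lamS lt|i]; rewrite /start_state.
    by do 2!case: eqP; lia.
  by case: eqP; lia.
- by move=> i; rewrite row_length_start.
- by move=> i; rewrite /start_state; have := lamL i; case: eqP; lia.
Qed.

Theorem theorem3p6 (R : realType) (n : nat) (lam : 'I_(n.*2) -> nat)
  (s : ST lam R[i]) :
  strict_partition lam ->
  STdiag s ->
  zetaQ_abs_cvg s ->
  (forall i j : 'I_(n.*2), (i < j)%N -> zetaQ_abs_cvg (pair_tableau s i j)) ->
  zetaQ s = pf (Mlam s).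
Proof.
move=> lamS sdiag sabs pabs.
have [sg sE] := STdiag_content (0 : R[i]) lamS sdiag.
pose L := (\max_i lam i)%N.
have lamL i : (lam i <= L)%N by exact: leq_bigmax.
have lim r (mu : 'I_r -> nat) (t : ST mu R[i]) : zetaQ_abs_cvg t ->
    ccvg (fun N => csum (@QSST_below r mu N) (zetaQ_term t)) (zetaQ t).
  move=> tabs; apply: csum_cvg => //; first exact: QSST_below_mono.
  exact: QSST_below_cover.
apply: ccvg_unique (lim _ _ _ sabs) _.
under eq_fun do rewrite (csum_below_pf _ lamS lamL sE).
apply: ccvg_pf => i j ij; rewrite mxE ij.
have pS : @strict_partition 1.*2 (lam \o pair_rows i j).
  by move=> [[|[|a]] ha] [[|[|b]] hb] //= _; exact: lamS.
have pL k : ((lam \o pair_rows i j) k <= L)%N by exact: lamL.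
have pE c : pair_tableau s i j c = sg (tagged c) by rewrite ffunE sE.
have := lim _ _ _ (pabs i j ij); congr (ccvg _ _); apply/funext => N.
by rewrite (@csum_below_pf _ 1 _ _ _ N L pS pL pE) pf1 !mxE.
Qed.
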